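(* Let $(G,\mu)$ be a profinite $C$-twisted topological group, and let $$1\to I\xrightarrow{\iota}Q\xrightarrow{\pi}G\to1$$ be an extension of profinite topological groups, where $G$ (resp. $I$) carries the quotient topology (resp. induced topology) from $Q$. Let $(V,\rho)$ be a $C$-admissible representation of $(Q,\pi^*\mu)$ such that $(V,\rho\iota)$ is a semisimple $C$-admissible representation of $I$. Assume that there exists a closed subgroup $I'$ of $I$, normal in $Q$, such that: (i) the image $\rho(I')$ of $I'$ by $\rho$ is finite; (ii) the quotient group $I/I'$ is topologically of finite type, and its centralizer in $Q/I'$ is open. Then there exist a finite family $(G_j)_{j\in J}$ of open subgroups of finite index in $G$ and, for each $j\in J$, a $C$-admissible multiplier $\nu_j$ on $G_j$, a $C$-admissible representation $W_j$ of $(G_j,\mu\nu_j^{-1})$, and a $C$-admissible representation $E_j$ of $(Q_j,\pi^*\nu_j)$, where $Q_j=\pi^{-1}(G_j)$, such that: (1) for each $j\in J$, the twisted representation $E_j$ has finite projective image, its restriction to $I$ is irreducible, and the action of $I$ on $E_j$ factors through $\rho(I)$; (2) the $C$-admissible representation $(V,\rho)$ of $(Q,\pi^*\mu)$ is isomorphic to the direct sum $$\bigoplus_{j\in J}\mathrm{Ind}_{Q_j}^Q(E_j\otimes_C\pi^*W_j).$$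
   Context: $\ell$ is a prime and $C$ is an algebraic closure of $\mathbb{Q}_\ell$ with the topology induced by the $\ell$-adic valuation. A map from a topological space to $C$ is $C$-admissible if it is continuous with image in a finite extension of $\mathbb{Q}_\ell$ in $C$. For a finite dimensional $C$-vector space $V$, a map $f$ to $\mathrm{Aut}_C(V)$ is $C$-admissible if there are a finite extension $E$ of $\mathbb{Q}_\ell$ in $C$ and an $E$-form $V_0$ of $V$ such that $f$ factors through a continuous map to $\mathrm{Aut}_E(V_0)$. A $C$-admissible multiplier on a topological group $G$ is a $C$-admissible map $\mu:G\times G\to C^\times$ with $\mu(1,1)=1$ and $\mu(x,y)\mu(xy,z)=\mu(x,yz)\mu(y,z)$. The pair $(G,\mu)$ is a $C$-twisted topological group. A $C$-admissible representation of $(G,\mu)$ is a finite dimensional $C$-vector space $V$ with a $C$-admissible map $\rho:G\to\mathrm{Aut}_C(V)$ such that $\rho(x)\rho(y)=\mu(x,y)\rho(xy)$; it has finite projective image if $G\to\mathrm{Aut}_C(V)/C^\times$ has finite image. In the extension, $(\pi^*\mu)(x,y)=\mu(\pi(x),\pi(y))$, which is trivial on $I$, so restrictions to $I$ are ordinary representations; $\pi^*W=W\circ\pi$. (In expressions such as $\mu\nu_j^{-1}$, $\mu$ means its restriction to $G_j$.) The tensor product of representations of $(G,\mu_1)$ and $(G,\mu_2)$ is a representation of $(G,\mu_1\mu_2)$. For $H\subseteq G$ open of finite index and $V$ a $C$-admissible representation of $(H,\mu|_H)$, $\mathrm{Ind}_H^GV=C[G,\mu]\otimes_{C[H,\mu|_H]}V$,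 where $C[G,\mu]$ has basis $([x])_{x\in G}$ and product $[x][y]=\mu(x,y)[xy]$. *)

(* Defs.v *)
From HB Require Import structures.
From mathcomp Require Import all_boot all_order all_algebra.
From mathcomp Require Import monoid ring_quotient finmap.
From mathcomp Require Import monalg ring.
From mathcomp Require Import boolp classical_sets functions cardinality topology.

Set Implicit Arguments.
Unset Strict Implicit.
Unset Printing Implicit Defensive.

Import Order.TTheory GRing.Theory Num.Theory.

Local Open Scope classical_set_scope.
Local Open Scope ring_scope.

(** * The field C *)

(* [Qlbar.type l] is the interface of the algebraic closures of Q_l, with the
   topology given by the l-adic valuation [valn], normalised by
   [valn l%:R = 1] and meaningful only on nonzero elements.  Inside C, the
   field Q_l is the closure of the prime field Q: the axioms [valn*] force the
   restriction of [valn] to Q to be the l-adic valuation, and [Ql_complete]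
   says that this closure is the completion of Q. *)
HB.mixin Record isQlbar (l : nat) C of GRing.ClosedField C & Topological C := {
  valn : C -> rat;
  pchar_Qlbar : [pchar C] =i pred0;
  valnM : forall x y : C, x != 0 -> y != 0 -> valn (x * y) = valn x + valn y;
  valnD : forall x y : C, x != 0 -> y != 0 -> x + y != 0 ->
    Num.min (valn x) (valn y) <= valn (x + y);
  valn_l : valn l%:R = 1;
  nbhs_valn : forall x : C, nbhs x =
    [set A : set C | exists N : rat,
       [set y | y != x -> N < valn (y - x)] `<=` A];
  Ql_complete : forall u : nat -> C,
    (forall n, closure (range (ratr : rat -> C)) (u n)) ->
    (forall N : rat, exists m, forall i j, (m <= i)%N -> (m <= j)%N ->
       u i != u j -> N < valn (u i - u j)) ->
    exists x : C, u @ \oo --> x;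
  Qlbar_algebraic : forall x : C, exists p : {poly C},
    [/\ p != 0, forall i, closure (range (ratr : rat -> C)) p`_i & root p x]
}.

#[short(type="qlbarType")]
HB.structure Definition Qlbar (l : nat) :=
  {C of GRing.ClosedField C & Topological C & isQlbar l C}.

Section Admissible.
Variables (l : nat) (C : qlbarType l).

Definition Ql : set C := closure (range (ratr : rat -> C)).

Definition finite_ext_Ql (E : set C) : Prop :=
  [/\ Ql `<=` E,
      forall x y, E x -> E y -> E (x - y),
      forall x y, E x -> E y -> E (x * y),
      forall x, E x -> E x^-1 &
      exists (n : nat) (e : 'I_n -> C), E =
        [set x | exists a : 'I_n -> C,
                 (forall i, Ql (a i)) /\ x = \sum_i a i * e i]].

(* The maps below are given by functions on the whole ambient space, whose
   values outside of the subspace [A] are irrelevant. *)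
Definition admissible_fun (T : topologicalType) (A : set T) (f : T -> C) :=
  {within A, continuous f} /\
  exists2 E, finite_ext_Ql E & forall x, A x -> E (f x).

(* The E-form is the E-span of the C-basis [b] of V; Aut_E of it is identified
   with GL_n(E) by means of [b]. *)
Definition admissible_aut (T : topologicalType) (A : set T) (V : vectType C)
    (f : T -> 'End(V)) :=
  (forall x, A x -> bijective (f x)) /\
  exists (E : set C) (b : (\dim {:V}).-tuple V),
    [/\ finite_ext_Ql E, basis_of {:V} b &
        forall i j : 'I_(\dim {:V}),
          (forall x, A x -> E (coord b i (f x b`_j))) /\
          {within A, continuous (fun x => coord b i (f x b`_j))}].

End Admissible.

(** * Topological groups *)

HB.mixin Record isTopologicalGroup G of Group G & Topological G := {
  mulg_continuous : continuous (fun p : G * G => (p.1 * p.2)%g);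
  invg_continuous : continuous (fun x : G => x^-1%g)
}.

#[short(type="topGroupType")]
HB.structure Definition TopologicalGroup :=
  {G of Group G & Topological G & isTopologicalGroup G}.

Definition profinite (G : topologicalType) :=
  [/\ compact [set: G], hausdorff_space G & totally_disconnected [set: G]].

Section Subgroups.
Variable G : groupType.
Implicit Type H : set G.

Definition is_subgroup H :=
  [/\ H 1%g, forall x y, H x -> H y -> H (x * y)%g & forall x, H x -> H x^-1%g].

Definition is_normal H :=
  is_subgroup H /\ forall g x, H x -> H (g * x * g^-1)%g.

Definition generated (S : set G) : set G := smallest is_subgroup S.

Definition lcoset_set H (x : G) : set G := [set (x * h)%g | h in H].

Definition finite_index H := finite_set [set lcoset_set H x | x in [set: G]].

Definition centralizer_set (S : set G) : set G :=
  [set x | forall s, S s -> (x * s = s * x)%g].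

End Subgroups.

Definition topologically_fg (G : topGroupType) :=
  exists2 S : set G, finite_set S & closure (generated S) = [set: G].

Definition is_quotient_by (Q G : topGroupType) (N : set Q)
    (p : {multiplicative Q -> G}) :=
  [/\ set_surj [set: Q] [set: G] p,
      p @^-1` [set 1%g] = N &
      forall U : set G, open U <-> open (p @^-1` U)].

(* [i] identifies I with a topological subgroup of Q. *)
Definition is_embedding (I Q : topGroupType) (i : {multiplicative I -> Q}) :=
  injective i /\
  forall U : set I, open U <-> exists2 W : set Q, open W & U = i @^-1` W.

(** * Twisted representations *)

Section Twisted.
Variables (l : nat) (C : qlbarType l) (G : topGroupType).

Definition multiplier_on (H : set G) (mu : G -> G -> C) :=
  [/\ admissible_fun (H `*` H) (fun p : G * G => mu p.1 p.2),
      forall x y, H x -> H y -> mu x y != 0,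
      mu 1%g 1%g = 1 &
      forall x y z, H x -> H y -> H z ->
        mu x y * mu (x * y)%g z = mu x (y * z)%g * mu y z].

Definition representation_on (H : set G) (mu : G -> G -> C) (V : vectType C)
    (rho : G -> 'End(V)) :=
  admissible_aut H rho /\
  forall x y, H x -> H y -> (rho x \o rho y)%VF = mu x y *: rho (x * y)%g.

Definition finite_projective_image (H : set G) (V : vectType C)
    (rho : G -> 'End(V)) :=
  finite_set [set [set c *: rho x | c in [set c : C | c != 0]] | x in H].

End Twisted.

Section Semisimple.
Variables (K : fieldType) (V : vectType K) (I : Type) (f : I -> 'End(V)).

Definition stable_under (U : {vspace V}) := forall x, (f x @: U <= U)%VS.

Definition irreducible_under (U : {vspace V}) :=
  [/\ stable_under U, U <> 0%VS &
      forall U' : {vspace V}, stable_under U' -> (U' <= U)%VS ->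
        U' = 0%VS \/ U' = U].

Definition semisimple :=
  exists (n : nat) (U : 'I_n -> {vspace V}),
    [/\ forall i, irreducible_under (U i),
        directv (\sum_i U i) & (\sum_i U i)%VS = fullv].

End Semisimple.

(** * Tensor products *)

Section LmodQuotient.
Variables (R : nzRingType) (M : lmodType R) (S : set M).

Definition is_submodule (N : set M) :=
  [/\ N 0, forall x y, N x -> N y -> N (x + y) &
      forall (c : R) x, N x -> N (c *: x)].

Definition span_pred : {pred M} := [pred x | `[< smallest is_submodule S x >]].

Fact span_pred_submod : submod_closed span_pred.
Proof.
split; first by apply/asboolP => N [[]].
move=> c x y /asboolP Nx /asboolP Ny; apply/asboolP => N NS.
have [[_ ND NZ] _] := NS.
by apply: ND; [apply: NZ; apply: Nx | apply: Ny].
Qed.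

HB.instance Definition _ :=
  GRing.isSubmodClosed.Build R M span_pred span_pred_submod.

End LmodQuotient.

Local Open Scope quotient_scope.

Section LmodQuotientStructure.
Variables (R : nzRingType) (M : lmodType R) (S : set M).

Definition lmod_quot : Type := Quotient.quot (span_pred S).

HB.instance Definition _ := GRing.Zmodule.on lmod_quot.
HB.instance Definition _ := Quotient.on lmod_quot.

Definition to_quot (x : M) : lmod_quot := \pi_lmod_quot x.

Lemma to_quotP (x y : M) :
  to_quot x = to_quot y <-> smallest (@is_submodule R M) S (x - y).
Proof.
split=> [/eqP|Sxy]; last apply/eqP.
  by rewrite -[_ == _](Quotient.idealrBE (span_pred S)) => /asboolP.
by rewrite -[_ == _](Quotient.idealrBE (span_pred S)); apply/asboolP.
Qed.

Fact to_quotD x y : to_quot (x + y) = to_quot x + to_quot y.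
Proof. exact: (Quotient.pi_add (span_pred S)). Qed.

Lemma reprqK (q : lmod_quot) : to_quot (repr q) = q.
Proof. exact: reprK. Qed.

Definition scaleq (c : R) (q : lmod_quot) : lmod_quot := to_quot (c *: repr q).

Fact to_quotZ c x : to_quot (c *: x) = scaleq c (to_quot x).
Proof.
apply/to_quotP => N NS; have [[_ _ NZ] _] := NS.
rewrite -scalerBr; apply: NZ.
by have /to_quotP := esym (reprqK (to_quot x)); apply.
Qed.

Fact scaleqA a b q : scaleq a (scaleq b q) = scaleq (a * b) q.
Proof. by rewrite -[q]reprqK -!to_quotZ scalerA. Qed.

Fact scale1q : left_id 1 scaleq.
Proof. by move=> q; rewrite -[q]reprqK -!to_quotZ scale1r. Qed.

Fact scaleqDr : right_distributive scaleq +%R.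
Proof.
move=> a p q; rewrite -[p]reprqK -[q]reprqK -to_quotD -!to_quotZ.
by rewrite scalerDr to_quotD.
Qed.

Fact scaleqDl q : {morph scaleq^~ q : a b / a + b}.
Proof. by move=> a b; rewrite -[q]reprqK -!to_quotZ scalerDl to_quotD. Qed.

HB.instance Definition _ := GRing.Zmodule_isLmodule.Build R lmod_quot
  scaleqA scale1q scaleqDr scaleqDl.

Fact to_quot_linear : linear to_quot.
Proof. by move=> c x y; rewrite to_quotD to_quotZ. Qed.

HB.instance Definition _ :=
  GRing.isLinear.Build R M lmod_quot _ to_quot to_quot_linear.

Lemma submodule_ker (P : lmodType R) (f : {linear M -> P}) :
  is_submodule [set x | f x = 0].
Proof.
split=> [|x y /= fx fy|c x /= fx]; first exact: linear0.
  by rewrite linearD fx fy addr0.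
by rewrite linearZ /= fx scaler0.
Qed.

Lemma quot_lift (P : lmodType R) (f : {linear M -> P}) (x y : M) :
  (forall s, S s -> f s = 0) -> to_quot x = to_quot y -> f x = f y.
Proof.
move=> fS /to_quotP/(_ _ (conj (submodule_ker f) fS)) /= /eqP.
by rewrite linearB subr_eq0 => /eqP.
Qed.

End LmodQuotientStructure.

Section Tensor.
Variables (R : comNzRingType) (A V : lmodType R).
(* [B] acts on the right of A by [ra] and on the left of V by [lv]. *)
Variables (B : Type) (ra : A -> B -> A) (lv : B -> V -> V).

Local Notation free := {malg R[(A * V)%type]}.
Local Notation gen a v := (<< (a, v) >> : free).

Variant tensor_rel : set free :=
| TensorDl a a' v : tensor_rel (gen (a + a') v - gen a v - gen a' v)
| TensorDr a v v' : tensor_rel (gen a (v + v') - gen a v - gen a v')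
| TensorZl (c : R) a v : tensor_rel (gen (c *: a) v - c *: gen a v)
| TensorZr (c : R) a v : tensor_rel (gen a (c *: v) - c *: gen a v)
| TensorB a b v : tensor_rel (gen (ra a b) v - gen a (lv b v)).

(* A (x)_B V, as an R-module *)
Definition tensor : Type := lmod_quot tensor_rel.
HB.instance Definition _ := GRing.Lmodule.on tensor.

Definition tens (a : A) (v : V) : tensor := to_quot tensor_rel (gen a v).

(* The map f (x) g.  It is computed on an arbitrary representative, and thus
   meaningful when f and g are linear and compatible with the actions of B,
   see [tensor_mapE]. *)
Definition tensor_map (f : A -> A) (g : V -> V) (t : tensor) : tensor :=
  let r := repr t : free in
  \sum_(k <- msupp r) r@_k *: tens (f k.1) (g k.2).

Let relE (z : free) : tensor_rel z -> to_quot tensor_rel z = 0.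
Proof.
move=> rz; rewrite -[RHS](linear0 (to_quot tensor_rel)).
by apply/to_quotP => N [_]; rewrite subr0; apply.
Qed.

Lemma tensDl a a' v : tens (a + a') v = tens a v + tens a' v.
Proof.
apply/eqP; rewrite /tens -subr_eq0 opprD addrA -!linearB; apply/eqP/relE.
exact: TensorDl.
Qed.

Lemma tensDr a v v' : tens a (v + v') = tens a v + tens a v'.
Proof.
apply/eqP; rewrite /tens -subr_eq0 opprD addrA -!linearB; apply/eqP/relE.
exact: TensorDr.
Qed.

Lemma tensZl c a v : tens (c *: a) v = c *: tens a v.
Proof.
by apply/eqP; rewrite /tens -subr_eq0 -linearZ -linearB; apply/eqP/relE/TensorZl.
Qed.

Lemma tensZr c a v : tens a (c *: v) = c *: tens a v.
Proof.
by apply/eqP; rewrite /tens -subr_eq0 -linearZ -linearB; apply/eqP/relE/TensorZr.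
Qed.

Lemma tensB a b v : tens (ra a b) v = tens a (lv b v).
Proof. by apply/eqP; rewrite /tens -subr_eq0 -linearB; apply/eqP/relE/TensorB. Qed.

Section Lift.
Variables (P : lmodType R) (h : A -> V -> P).

Definition free_lift (z : free) : P := \sum_(k <- msupp z) z@_k *: h k.1 k.2.

Lemma free_liftEw (d : {fset A * V}) (z : free) : (msupp z `<=` d)%fset ->
  free_lift z = \sum_(k <- d) z@_k *: h k.1 k.2.
Proof.
move=> zd; rewrite /free_lift (big_fset_incl _ zd) // => k _ /mcoeff_outdom ->.
by rewrite scale0r.
Qed.

Fact free_lift_linear : linear free_lift.
Proof.
move=> c x y.
pose d := (msupp x `|` msupp y `|` msupp (c *: x + y))%fset.
have dx : (msupp x `<=` d)%fset by rewrite /d -fsetUA fsubsetUl.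
have dy : (msupp y `<=` d)%fset by rewrite /d fsetUAC fsubsetUr.
have dxy : (msupp (c *: x + y) `<=` d)%fset by rewrite fsubsetUr.
rewrite (free_liftEw dx) (free_liftEw dy) (free_liftEw dxy) scaler_sumr.
rewrite -big_split /=; apply: eq_bigr => k _.
by rewrite mcoeffD mcoeffZ scalerDl scalerA.
Qed.

HB.instance Definition _ :=
  GRing.isLinear.Build R free P _ free_lift free_lift_linear.

Lemma free_liftU a v : free_lift (gen a v) = h a v.
Proof.
rewrite (@free_liftEw [fset (a, v)]%fset) ?msuppU_le //.
by rewrite big_seq_fset1 mcoeffUU scale1r.
Qed.

Hypothesis hDl : forall a a' v, h (a + a') v = h a v + h a' v.
Hypothesis hDr : forall a v v', h a (v + v') = h a v + h a v'.
Hypothesis hZl : forall c a v, h (c *: a) v = c *: h a v.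
Hypothesis hZr : forall c a v, h a (c *: v) = c *: h a v.
Hypothesis hB : forall a b v, h (ra a b) v = h a (lv b v).

Lemma free_lift_rel z : tensor_rel z -> free_lift z = 0.
Proof.
case=> *; rewrite !(linearB, linearZ) /= !free_liftU.
- by rewrite hDl -addrA -opprD subrr.
- by rewrite hDr -addrA -opprD subrr.
- by rewrite hZl scalerN subrr.
- by rewrite hZr scalerN subrr.
- by rewrite hB subrr.
Qed.

Lemma tensor_liftE a v : free_lift (repr (tens a v)) = h a v.
Proof.
rewrite -(free_liftU a v); apply: quot_lift free_lift_rel _.
exact: reprqK.
Qed.

Lemma tensor_universal :
  exists phi : {linear tensor -> P}, forall a v, phi (tens a v) = h a v.
Proof.
pose phi (t : tensor) := free_lift (repr t).
have phi_lin : linear phi.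
  move=> c x y; rewrite /phi -linearP; apply: quot_lift free_lift_rel _.
  by rewrite linearP /= !reprqK.
pose phi_linear := GRing.isLinear.Build _ _ _ _ phi phi_lin.
pose phiL : {linear tensor -> P} := HB.pack phi phi_linear.
by exists phiL => a v; exact: tensor_liftE.
Qed.

End Lift.

Lemma tensor_ext (P : lmodType R) (phi psi : {linear tensor -> P}) :
  (forall a v, phi (tens a v) = psi (tens a v)) -> phi =1 psi.
Proof.
move=> e t; rewrite -[t]reprqK [repr t]monalgE !linear_sum /=.
apply: eq_bigr => -[a v] _; set c := _@_(a, v).
have -> : << c *g (a, v) >> = c *: gen a v :> free.
  by apply/malgP => k; rewrite mcoeffZ !mcoeffU mulr_natr.
by rewrite !linearZ /= e.
Qed.

Lemma tensor_mapE (f : {linear A -> A}) (g : {linear V -> V}) :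
  (forall a b, f (ra a b) = ra (f a) b) ->
  (forall b v, g (lv b v) = lv b (g v)) ->
  forall a v, tensor_map f g (tens a v) = tens (f a) (g v).
Proof.
move=> fB gB a v.
apply: (tensor_liftE (h := fun a v => tens (f a) (g v))) => *.
- by rewrite linearD tensDl.
- by rewrite linearD tensDr.
- by rewrite linearZ tensZl.
- by rewrite linearZ tensZr.
- by rewrite fB gB tensB.
Qed.

End Tensor.

(** * The twisted group algebra and induction *)

Section TwistedAlgebra.
Variables (R : comNzRingType) (G : groupType) (mu : G -> G -> R).

(* C[G, mu] is {malg R[G]}, with [x] = << x >> and the following product. *)
Definition tw_mul (a b : {malg R[G]}) : {malg R[G]} :=
  \sum_(x <- msupp a) \sum_(y <- msupp b)
    (a@_x * b@_y * mu x y) *: << (x * y)%g >>.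

Lemma tw_mulEw (d1 d2 : {fset G}) a b :
  (msupp a `<=` d1)%fset -> (msupp b `<=` d2)%fset ->
  tw_mul a b = \sum_(x <- d1) \sum_(y <- d2)
    (a@_x * b@_y * mu x y) *: << (x * y)%g >>.
Proof.
move=> d1a d2b; rewrite /tw_mul (big_fset_incl _ d1a) /=; last first.
  move=> x _ /mcoeff_outdom ->; rewrite big1 // => y _.
  by rewrite !mul0r scale0r.
apply: eq_bigr => x _; rewrite (big_fset_incl _ d2b) //= => y _.
by move=> /mcoeff_outdom ->; rewrite mulr0 mul0r scale0r.
Qed.

Lemma tw_mulUU x y :
  tw_mul << x >> << y >> = mu x y *: << (x * y)%g >>.
Proof.
rewrite (@tw_mulEw [fset x]%fset [fset y]%fset) ?msuppU_le //.
by rewrite !big_seq_fset1 !mcoeffUU !mul1r.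
Qed.

Fact tw_mul_linear a : linear (tw_mul a).
Proof.
move=> c b b'.
pose d := (msupp b `|` msupp b' `|` msupp (c *: b + b'))%fset.
rewrite !(@tw_mulEw (msupp a) d) /d ?fsubsetUr -?fsetUA ?fsubsetUl //; last first.
  by rewrite fsetUCA fsubsetUl.
rewrite scaler_sumr -big_split /=; apply: eq_bigr => x _.
rewrite scaler_sumr -big_split /=; apply: eq_bigr => y _.
rewrite scalerA -scalerDl; congr (_ *: _).
by rewrite mcoeffD mcoeffZ mulrDr mulrDl mulrCA -!mulrA.
Qed.

HB.instance Definition _ a :=
  GRing.isLinear.Build R {malg R[G]} {malg R[G]} _ (tw_mul a) (tw_mul_linear a).

Lemma tw_mul_linearl b : linear (tw_mul^~ b).
Proof.
move=> c a a'.
pose d := (msupp a `|` msupp a' `|` msupp (c *: a + a'))%fset.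
rewrite !(@tw_mulEw d (msupp b)) /d ?fsubsetUr -?fsetUA ?fsubsetUl //; last first.
  by rewrite fsetUCA fsubsetUl.
rewrite scaler_sumr -big_split /=; apply: eq_bigr => x _.
rewrite scaler_sumr -big_split /=; apply: eq_bigr => y _.
rewrite scalerA -scalerDl; congr (_ *: _).
by rewrite mcoeffD mcoeffZ !mulrDl -!mulrA.
Qed.

Lemma malg_span (a : {malg R[G]}) : a = \sum_(x <- msupp a) a@_x *: << x >>.
Proof.
rewrite {1}[a]monalgE; apply: eq_bigr => x _.
by apply/malgP => k; rewrite mcoeffZ !mcoeffU mulr_natr.
Qed.

Lemma tw_mulA :
  (forall x y z, mu x y * mu (x * y)%g z = mu x (y * z)%g * mu y z) ->
  associative tw_mul.
Proof.
move=> muA a b c.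
have sumr (I : Type) (r : seq I) (F : I -> {malg R[G]}) e :
    tw_mul (\sum_(i <- r) F i) e = \sum_(i <- r) tw_mul (F i) e.
  pose f_linear := GRing.isLinear.Build _ _ _ _ (tw_mul^~ e) (tw_mul_linearl e).
  pose f : {linear {malg R[G]} -> {malg R[G]}} := HB.pack (tw_mul^~ e) f_linear.
  exact: (linear_sum f).
have Zr k u v : tw_mul (k *: u) v = k *: tw_mul u v.
  have := tw_mul_linearl v k u 0; rewrite addr0 => ->.
  have -> : tw_mul 0 v = 0; last by rewrite addr0.
  by rewrite /tw_mul msupp0 big_seq_fset0.
have suml (I : Type) (r : seq I) (F : I -> {malg R[G]}) e :
    tw_mul e (\sum_(i <- r) F i) = \sum_(i <- r) tw_mul e (F i).
  exact: linear_sum.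
have Zl k u v : tw_mul u (k *: v) = k *: tw_mul u v by rewrite linearZ.
move: tw_mul sumr Zr suml Zl tw_mulUU => m sumr Zr suml Zl mUU.
have mA (r s t : seq G) (f g h : G -> {malg R[G]}) :
    (forall x y z, m (f x) (m (g y) (h z)) = m (m (f x) (g y)) (h z)) ->
    m (\sum_(x <- r) f x) (m (\sum_(y <- s) g y) (\sum_(z <- t) h z)) =
    m (m (\sum_(x <- r) f x) (\sum_(y <- s) g y)) (\sum_(z <- t) h z).
  move=> e; rewrite !sumr; apply: eq_bigr => x _.
  rewrite !(suml _ s) sumr; apply: eq_bigr => y _.
  by rewrite !suml; apply: eq_bigr => z _.
rewrite [a]malg_span [b]malg_span [c]malg_span; apply: mA => x y z.
rewrite !(Zl, Zr, mUU) !scalerA mulgA; congr (_ *: _).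
by ring: (muA x y z).
Qed.

(* The elements of the subalgebra C[H, mu|H], and their action on a
   representation [sigma] of (H, mu|H). *)
Definition tw_sub (H : set G) : Type :=
  {b : {malg R[G]} | forall h, h \in msupp b -> H h}.

Definition tw_act (H : set G) (T : lmodType R) (sigma : G -> T -> T)
    (b : tw_sub H) (t : T) : T :=
  \sum_(h <- msupp (sval b)) (sval b)@_h *: sigma h t.

Definition induced (H : set G) (T : lmodType R) (sigma : G -> T -> T) : Type :=
  @tensor R {malg R[G]} T (tw_sub H) (fun a b => tw_mul a (sval b))
    (tw_act sigma).
HB.instance Definition _ H T sigma :=
  GRing.Lmodule.on (@induced H T sigma).

Definition induced_act (H : set G) (T : lmodType R) (sigma : G -> T -> T)
    (x : G) (u : induced H sigma) : induced H sigma :=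
  tensor_map (tw_mul << x >>) id u.

Lemma induced_actE (H : set G) (T : lmodType R) (sigma : G -> T -> T) x a t :
  (forall x y z, mu x y * mu (x * y)%g z = mu x (y * z)%g * mu y z) ->
  induced_act x (tens _ _ a t : induced H sigma) =
  tens _ _ (tw_mul << x >> a) t.
Proof.
move=> muA; apply: (tensor_mapE (f := tw_mul << x >>) (g := idfun)) => // c b.
exact: tw_mulA.
Qed.

End TwistedAlgebra.

Section TensorRepresentation.
Variables (R : comNzRingType) (G : Type) (E W : lmodType R).

(* E (x)_C W *)
Definition tensor_sp : Type :=
  @tensor R E W R (fun e c => c *: e) (fun c w => c *: w).
HB.instance Definition _ := GRing.Lmodule.on tensor_sp.

Definition tensor_rep (r : G -> E -> E) (s : G -> W -> W) (x : G)
    (t : tensor_sp) : tensor_sp := tensor_map (r x) (s x) t.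

Lemma tensor_repE (r : G -> {linear E -> E}) (s : G -> {linear W -> W}) x e w :
  tensor_rep r s x (tens _ _ e w) = tens _ _ (r x e) (s x w).
Proof. by apply: tensor_mapE => *; rewrite linearZ. Qed.

End TensorRepresentation.

(* The last clause says that [F], defined on the direct sum of the [T j],
   is compatible with the actions of G. *)
Definition direct_sum_isomorphic (R : nzRingType) (G : Type) (V : lmodType R)
    (rho : G -> V -> V) (J : finType) (T : J -> lmodType R)
    (act : forall j, G -> T j -> T j) :=
  exists F : (forall j, T j) -> V,
    [/\ bijective F,
        forall s t, F (fun j => s j + t j) = F s + F t,
        forall (c : R) t, F (fun j => c *: t j) = c *: F t &
        forall x t, F (fun j => act j x (t j)) = rho x (F t)].

(* Main.v *)
Require Import Defs.
From HB Require Import structures.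
From mathcomp Require Import all_boot all_order all_algebra.
From mathcomp Require Import monoid boolp classical_sets functions cardinality.
From mathcomp Require Import topology ring finmap monalg.

(** The argument is Clifford theory, with topology added.

    Decompose V into irreducible I-modules E_i.  The operator rho(q) carries
    E_i to a submodule whose I-action is that of E_i conjugated by q, so Q
    permutes the isomorphism classes of the E_i.  The family J is the set of
    orbits of this action, Q_j is the stabiliser of the class of a
    representative E_j, and G_j is its image in G.  The stabiliser is open
    because it is the locus where some block of the matrix of rho(q) does not
    vanish ([stabilizerE], [stabilizer_open]), and it has finite index because
    there are finitely many classes.  V is the direct sum, over J, of the
    representations induced from the isotypic components V_j
    ([sum_of_induced]).

    It remains to factor V_j as E_j (x) W_j, where W_j is the multiplicity
    space ([orbit_factorization]).  In a decomposition of V_j into N copies of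
    E_j, an element q of Q_j acts by an N by N array of blocks X_ab(q), which
    are operators of E_j.  All of them intertwine the action of I with its
    conjugate by q, so by Schur's lemma they are proportional:
    X_ab(q) = B_ab(q) A(q).  Here A(q) is well defined up to a scalar, and any
    choice yields projective representations A of Q_j on E_j and B on W_j with
    opposite multipliers, up to mu.  A choice must satisfy two requirements:
    A has to be continuous, and A(q x) = A(q) x for x in I, so that the
    multiplier nu of A, and B, come from G_j.  Take for A(q) a block X_ab(q)
    whose coefficient B_ab(q) has the smallest valuation.  The set of the
    optimal indices (a, b) does not depend on the scaling of B, hence it only
    depends on the class of q in G_j, and it is locally constant because the
    valuation of a nonzero element of C is locally constant ([min_valn_near]).
    So A is locally one of the blocks of rho.  The functions nu and B are then
    locally quotients of matrix coefficients, which makes them admissible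
    ([adm_quotient]); that finitely many finite extensions of Q_l lie in a
    common one is [finite_ext_big].

    The projective image of A is finite since A(q) modulo scalars is determined
    by its conjugation action on the image of I.  By (i) and (ii) this action
    is determined by its values at finitely many x in I
    ([finite_generation]), and each x has finitely many conjugates under Q, as
    far as rho can see ([finite_conjugates]): a subgroup of finite index of Q
    moves x by elements of I', and rho(I') is finite. *)

Set Implicit Arguments.
Unset Strict Implicit.
Unset Printing Implicit Defensive.

Import Order.TTheory GRing.Theory Num.Theory.

Local Open Scope classical_set_scope.
Local Open Scope ring_scope.

(** * Limits in C *)

Section Valuation.
Variables (l : nat) (C : qlbarType l).
Implicit Types (x y a b : C) (N M : rat).

Lemma valn1 : valn (1 : C) = 0.
Proof.
have := @valnM l C 1 1 (oner_neq0 _) (oner_neq0 _); rewrite mulr1 => /esym/eqP.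
by rewrite -subr_eq0 addrK => /eqP.
Qed.

Lemma valnN x : x != 0 -> valn (- x) = valn x.
Proof.
have valnN1 : valn (-1 : C) = 0.
  have n1 : (-1 : C) != 0 by rewrite oppr_eq0 oner_neq0.
  have := valnM _ _ n1 n1; rewrite mulrNN mulr1 valn1 => /esym/eqP.
  by rewrite -mulr2n mulrn_eq0 /= => /eqP.
by move=> x0; rewrite -mulN1r valnM ?oppr_eq0 ?oner_neq0 // valnN1 add0r.
Qed.

Lemma valnV x : x != 0 -> valn x^-1 = - valn x.
Proof.
move=> x0; have := valnM x x^-1 x0; rewrite invr_eq0 => /(_ x0).
by rewrite mulfV // valn1 => /esym/eqP; rewrite addr_eq0 => /eqP ->; rewrite opprK.
Qed.

(** The valuation of 0 is infinite by convention. *)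
Definition valn_gt N x := x != 0 -> N < valn x.

Lemma valn_gt0 N : valn_gt N 0. Proof. by rewrite /valn_gt eqxx. Qed.

Lemma valn_gtN N x : valn_gt N x -> valn_gt N (- x).
Proof. by move=> h; rewrite /valn_gt oppr_eq0 => x0; rewrite valnN // h. Qed.

Lemma valn_gtD N x y : valn_gt N x -> valn_gt N y -> valn_gt N (x + y).
Proof.
have [->|x0] := eqVneq x 0; first by rewrite add0r.
have [->|y0] := eqVneq y 0; first by rewrite addr0.
move=> hx hy xy0; apply: lt_le_trans (valnD _ _ x0 y0 xy0).
by rewrite lt_min hx ?hy.
Qed.

Lemma valn_gtM N M x y : valn_gt N x -> valn_gt M y -> valn_gt (N + M) (x * y).
Proof.
move=> hx hy; rewrite /valn_gt mulf_eq0 negb_or => /andP[x0 y0].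
by rewrite valnM // ltrD ?hx ?hy.
Qed.

Lemma valn_gtW N M x : N <= M -> valn_gt M x -> valn_gt N x.
Proof. by move=> NM h x0; apply: le_lt_trans NM (h x0). Qed.

Lemma valn_gt_ex x : exists N, valn_gt N x.
Proof. by exists (valn x - 1) => _; rewrite ltrBlDr ltrDl. Qed.

(** By the ultrametric inequality the valuation is constant near a nonzero
    element; most continuity statements below rest on this. *)
Lemma valn_near x y : y != 0 -> valn_gt (valn y) (x - y) ->
  x != 0 /\ valn x = valn y.
Proof.
move=> y0 h; have x0 : x != 0.
  apply: contraTneq isT => x0; move: h; rewrite x0 sub0r => /(_ _).
  by rewrite oppr_eq0 y0 valnN // ltxx => /(_ isT).
split=> //; have [e|d] := eqVneq (x - y) 0; first by rewrite (subr0_eq e).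
have hd := h d; apply/eqP; rewrite eq_le; apply/andP; split; last first.
  have := @valnD l C (x - y) y d y0; rewrite subrK => /(_ x0).
  by rewrite min_r // ltW.
rewrite leNgt; apply/negP => xy; have := @valnD l C x (- (x - y)) x0.
rewrite oppr_eq0 d => /(_ isT); rewrite opprB addrC subrK => /(_ y0).
by rewrite leNgt -opprB valnN // lt_min xy hd.
Qed.

Lemma nbhs_valn_gt x N : nbhs x [set y | valn_gt N (y - x)].
Proof. by rewrite nbhs_valn; exists N => y /= h; rewrite /valn_gt subr_eq0. Qed.

Lemma cvgCP (T : Type) (F : set_system T) (FF : Filter F) (f : T -> C) a :
  f @ F --> a <-> forall N, \forall t \near F, valn_gt N (f t - a).
Proof.
split=> [fa N|h A]; first exact: fa (nbhs_valn_gt a N).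
rewrite nbhs_valn => -[N NA]; apply: filterS (h N) => t ht.
by apply: NA => /=; rewrite -subr_eq0.
Qed.

Section Limits.
Variables (T : Type) (F : set_system T) (FF : Filter F).
Implicit Types f g : T -> C.

Lemma cvgC_D f g a b :
  f @ F --> a -> g @ F --> b -> (fun t => f t + g t) @ F --> a + b.
Proof.
move=> /cvgCP fa /cvgCP gb; apply/cvgCP => N.
near=> t; rewrite opprD addrACA; apply: valn_gtD; near: t; [exact: fa|exact: gb].
Unshelve. all: by end_near. Qed.

Lemma cvgC_M f g a b :
  f @ F --> a -> g @ F --> b -> (fun t => f t * g t) @ F --> a * b.
Proof.
move=> /cvgCP fa /cvgCP gb; apply/cvgCP => N.
have [Na ha] := valn_gt_ex a; have [Nb hb] := valn_gt_ex b.
near=> t; have -> : f t * g t - a * b =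
    (f t - a) * (g t - b) + a * (g t - b) + (f t - a) * b.
  by ring.
apply: valn_gtD; first apply: valn_gtD.
- rewrite -[N]addr0; apply: valn_gtM; near: t; [exact: fa|exact: gb].
- by rewrite -(subrKC Na N); apply: valn_gtM => //; near: t; exact: gb.
- by rewrite -(subrK Nb N); apply: valn_gtM => //; near: t; exact: fa.
Unshelve. all: by end_near. Qed.

Lemma cvgC_V f a : a != 0 -> f @ F --> a -> (fun t => (f t)^-1) @ F --> a^-1.
Proof.
move=> a0 /cvgCP fa; apply/cvgCP => N; near=> t.
have [ft0 vft] : f t != 0 /\ valn (f t) = valn a.
  by apply: valn_near => //; near: t; exact: fa.
have -> : (f t)^-1 - a^-1 = - ((f t - a) * (f t * a)^-1).
  by field; rewrite ft0 a0.
apply: valn_gtN => nz; have := nz; rewrite mulf_eq0 negb_or => /andP[d0 i0].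
rewrite valnM // valnV ?mulf_neq0 // valnM // vft ltrBrDr.
by move: d0; near: t; exact: fa.
Unshelve. all: by end_near. Qed.

End Limits.

Lemma near_neq0 (T : Type) (F : set_system T) (FF : Filter F) (f : T -> C) a :
  a != 0 -> f @ F --> a -> \forall t \near F, f t != 0.
Proof.
move=> a0 /cvgCP/(_ (valn a)) fa; near=> t.
by have [] : f t != 0 /\ valn (f t) = valn a by apply: valn_near => //; near: t.
Unshelve. all: by end_near. Qed.

End Valuation.

(** * Finite extensions of Q_l in C *)

Section FiniteExtensions.
Variables (l : nat) (C : qlbarType l).
Implicit Types (x y : C) (E F : set C).

Local Notation Ql := (@Ql l C).

Lemma intrC_eq0 (m : int) : (m%:~R == 0 :> C) = (m == 0).
Proof.
have natC : forall n, (n%:R == 0 :> C) = (n == 0%N).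
  by apply/pcharf0P; exact: (@pchar_Qlbar l C).
case: m => n; first by rewrite -[_%:~R]/(n%:R) natC.
by rewrite NegzE rmorphN oppr_eq0 /= -[_%:~R]/(n.+1%:R) natC.
Qed.

(** Nonzero integers are invertible in C, which has characteristic zero, so
    fractions can be compared by cross-multiplication. *)
Lemma range_ratrP x : range (ratr : rat -> C) x <->
  exists m n : int, n != 0 /\ x = m%:~R / n%:~R.
Proof.
split=> [[q _ <-]|[m [n [n0 ->]]]].
  by exists (numq q), (denq q); rewrite denq_neq0.
exists (m%:~R / n%:~R) => //; rewrite /ratr; set q : rat := _ / _.
have : (numq q * n = m * denq q)%R.
  apply: (@intr_inj rat); rewrite !rmorphM /= numqE /q.
  by rewrite mulrAC divfK ?intr_eq0.
move/(congr1 (fun z : int => z%:~R : C)); rewrite !rmorphM /= => e.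
have d0 : ((denq q)%:~R : C) != 0 by rewrite intrC_eq0 denq_neq0.
have n0' : (n%:~R : C) != 0 by rewrite intrC_eq0.
by apply: (mulIf d0); rewrite divfK // mulrAC -e mulfK.
Qed.

Lemma QlP x : Ql x <-> forall N, exists q : C,
  range (ratr : rat -> C) q /\ valn_gt N (x - q).
Proof.
split=> [Qx N|h A].
  have [q [qr hq]] := Qx _ (nbhs_valn_gt x N); exists q; split=> //.
  by rewrite -opprB; apply: valn_gtN.
rewrite nbhs_valn => -[N NA]; have [q [qr hq]] := h N.
exists q; split=> //; apply: NA => /= qx.
by have := valn_gtN hq; rewrite opprB => -> //; rewrite subr_eq0.
Qed.

Lemma Ql_sub x y : Ql x -> Ql y -> Ql (x - y).
Proof.
move=> /QlP hx /QlP hy; apply/QlP => N.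
have [_ [/range_ratrP[m [n [n0 ->]]] hp]] := hx N.
have [_ [/range_ratrP[m' [n' [n0' ->]]] hq]] := hy N.
exists (m%:~R / n%:~R - m'%:~R / n'%:~R); split; last first.
  by have := valn_gtD hp (valn_gtN hq); congr valn_gt; ring.
apply/range_ratrP; exists (m * n' - m' * n), (n * n').
rewrite mulf_neq0 //; split=> //; rewrite !rmorphB !rmorphM /=.
by field; rewrite !intrC_eq0 n0 n0'.
Qed.

Lemma Ql1 : Ql 1.
Proof.
apply: subset_closure; apply/range_ratrP; exists 1, 1.
by rewrite oner_neq0 divr1.
Qed.

Lemma Ql_mul x y : Ql x -> Ql y -> Ql (x * y).
Proof.
move=> Qx Qy.
have [->|x0] := eqVneq x 0; first by rewrite mul0r -(subrr 1); apply: Ql_sub; exact: Ql1.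
have [->|y0] := eqVneq y 0; first by rewrite mulr0 -(subrr 1); apply: Ql_sub; exact: Ql1.
move: Qx Qy => /QlP hx /QlP hy; apply/QlP => N.
have [q [qr hq]] := hy (Num.max (N - valn x) (valn y)).
have q0 : q != 0.
  have [] // := @valn_near l C q y y0.
  by rewrite -opprB; apply: valn_gtN; apply: valn_gtW hq; rewrite le_max lexx orbT.
have [p [pr hp]] := hx (N - valn q).
exists (p * q); split.
  move: pr qr => /range_ratrP[m [n [n0 ->]]] /range_ratrP[m' [n' [n0' ->]]].
  apply/range_ratrP; exists (m * m'), (n * n').
  rewrite mulf_neq0 //; split=> //; rewrite !rmorphM /=.
  by field; rewrite !intrC_eq0 n0 n0'.
have -> : x * y - p * q = x * (y - q) + (x - p) * q by ring.
apply: valn_gtD => nz; have := nz; rewrite mulf_eq0 negb_or => /andP[u0 v0].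
  rewrite valnM // addrC -ltrBlDr; apply: le_lt_trans (hq v0).
  by rewrite le_max lexx.
by rewrite valnM // -ltrBlDr; apply: hp.
Qed.

Lemma Ql_inv x : Ql x -> Ql x^-1.
Proof.
have [->|x0] := eqVneq x 0; first by rewrite invr0.
move=> /QlP hx; apply/QlP => N.
have [q [qr hq]] := hx (Num.max (N + valn x + valn x) (valn x)).
have [q0 vq] : q != 0 /\ valn q = valn x.
  apply: valn_near => //.
  by rewrite -opprB; apply: valn_gtN; apply: valn_gtW hq; rewrite le_max lexx orbT.
exists q^-1; split.
  move: qr => /range_ratrP[m [n [n0 e]]].
  apply/range_ratrP; exists n, m; rewrite e invf_div; split=> //.
  by apply: contraNneq q0; rewrite e => ->; rewrite mul0r.
have -> : x^-1 - q^-1 = - ((x - q) * (x * q)^-1) by field; rewrite x0 q0.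
apply: valn_gtN => nz; have := nz; rewrite mulf_eq0 negb_or => /andP[u0 v0].
rewrite valnM // valnV ?mulf_neq0 // valnM // vq ltrBrDr addrA.
by apply: le_lt_trans (hq u0); rewrite le_max lexx.
Qed.

Definition field_over_Ql E := [/\ Ql `<=` E,
  forall x y, E x -> E y -> E (x - y),
  forall x y, E x -> E y -> E (x * y) & forall x, E x -> E x^-1].

Lemma finite_ext_field E : finite_ext_Ql E -> field_over_Ql E.
Proof. by case. Qed.

Section Field.
Variables (E : set C) (hE : field_over_Ql E).

Lemma fieldE1 : E 1. Proof. by case: hE => + _ _ _; apply; exact: Ql1. Qed.

Lemma fieldE0 : E 0.
Proof. by rewrite -(subrr 1); case: hE => _ + _ _; apply; exact: fieldE1. Qed.

Lemma fieldE_N x : E x -> E (- x).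
Proof. by move=> Ex; rewrite -sub0r; case: hE => _ + _ _; apply => //; exact: fieldE0. Qed.

Lemma fieldE_D x y : E x -> E y -> E (x + y).
Proof.
move=> Ex Ey; rewrite -[y]opprK; case: hE => _ + _ _; apply => //.
exact: fieldE_N.
Qed.

Lemma fieldE_M x y : E x -> E y -> E (x * y).
Proof. by case: hE => _ _ + _; apply. Qed.

Lemma fieldE_sum (I : Type) (r : seq I) (P : pred I) (f : I -> C) :
  (forall i, P i -> E (f i)) -> E (\sum_(i <- r | P i) f i).
Proof. by move=> Ef; apply: big_ind => //; [exact: fieldE0|exact: fieldE_D]. Qed.

End Field.

Lemma Ql_field : field_over_Ql Ql.
Proof. by split=> //; [exact: Ql_sub|exact: Ql_mul|exact: Ql_inv]. Qed.

Lemma Ql_finite_ext : finite_ext_Ql Ql.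
Proof.
have [h1 h2 h3 h4] := Ql_field; split=> //.
exists 1%N, (fun=> 1); apply/seteqP; split=> x /=.
  by move=> Qx; exists (fun=> x); rewrite big_ord1 mulr1.
by move=> [a [Qa ->]]; rewrite big_ord1 mulr1.
Qed.

(** A ring that contains Ql is a field because its elements are algebraic over
    Ql: the inverse of a nonzero y is a polynomial in y with coefficients in
    Ql, obtained from an annihilating polynomial with nonzero constant term. *)
Lemma ring_over_Ql_inv E : Ql `<=` E ->
  (forall x y, E x -> E y -> E (x - y)) ->
  (forall x y, E x -> E y -> E (x * y)) -> forall x, E x -> E x^-1.
Proof.
move=> QE EB EM y Ey; have E1 : E 1 by apply/QE/Ql1.
have E0 : E 0 by rewrite -(subrr 1); apply: EB.
have [->|y0] := eqVneq y 0; first by rewrite invr0.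
have EN x : E x -> E (- x) by move=> Ex; rewrite -sub0r; apply: EB.
have ED x z : E x -> E z -> E (x + z).
  by move=> Ex Ez; rewrite -[z]opprK; apply/EB/EN.
have horner_E (q : {poly C}) : (forall i, Ql q`_i) -> E q.[y].
  elim/poly_ind: q => [|q c IH] hq; first by rewrite horner0.
  rewrite hornerMXaddC; apply: ED; first apply: EM => //.
    by apply: IH => i; have := hq i.+1; rewrite coefD coefMX coefC addr0.
  by apply: QE; have := hq 0%N; rewrite coefD coefMX coefC add0r.
have [p [p0 pQ py]] := Qlbar_algebraic y.
suff [q [q0 qQ qy]] : exists q : {poly C},
    [/\ q`_0 != 0, forall i, Ql q`_i & root q y].
  pose r := drop_poly 1 q.
  have eq_q : q.[y] = r.[y] * y + q`_0.
    rewrite -{1}(poly_take_drop 1 q) hornerD hornerM hornerXn expr1 addrC.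
    congr (_ + _); rewrite /take_poly poly_def big_ord1.
    by rewrite expr0 alg_polyC hornerC.
  have -> : y^-1 = - (r.[y] * (q`_0)^-1).
    move: qy => /eqP; rewrite eq_q => /eqP; rewrite addr_eq0 => /eqP e.
    by apply: (mulIf y0); rewrite mulVf // mulNr mulrAC e mulNr opprK mulfV.
  apply: EN; apply: EM; last by apply/QE/Ql_inv.
  by apply: horner_E => i; rewrite coef_drop_poly.
elim/poly_ind: p p0 pQ py => [|p c IH]; first by rewrite eqxx.
have [->|c0] := eqVneq c 0; last first.
  move=> _ pQ py; exists (p * 'X + c%:P); split=> //.
  by rewrite coefD coefMX coefC add0r.
rewrite addr0 => p0 pQ; rewrite rootM rootX (negPf y0) orbF; apply: IH.
  by apply: contraNneq p0 => ->; rewrite mul0r.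
by move=> i; have := pQ i.+1; rewrite coefMX.
Qed.

Lemma monic_annihilator x : exists p : {poly C},
  [/\ p \is monic, forall i, Ql p`_i & root p x].
Proof.
have [p [p0 pQ px]] := Qlbar_algebraic x.
exists ((lead_coef p)^-1 *: p); split.
- by rewrite monicE lead_coefZ mulVf ?lead_coef_eq0.
- by move=> i; rewrite coefZ; exact: Ql_mul (Ql_inv (pQ _)) (pQ i).
- by rewrite rootZ // invr_eq0 lead_coef_eq0.
Qed.

(** E[x] is the set of values at x of the polynomials over E.  It is a field by
    [ring_over_Ql_inv], and reduction modulo a monic annihilator of x bounds the
    degree of the polynomials, hence the dimension. *)
Lemma adjoin_finite_ext E x : finite_ext_Ql E ->
  exists F, [/\ finite_ext_Ql F, E `<=` F & F x].
Proof.
move=> hE; have fE := finite_ext_field hE; have [_ _ _ _ [n [e eE]]] := hE.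
pose F := [set y | exists p : {poly C}, (forall i, E p`_i) /\ y = p.[x]].
have EF : E `<=` F.
  move=> y Ey; exists y%:P; rewrite hornerC; split=> // i; rewrite coefC.
  by case: eqP => // _; exact: fieldE0.
have QF : Ql `<=` F by case: fE => h _ _ _; apply: subset_trans h EF.
have FB y z : F y -> F z -> F (y - z).
  move=> [p [pE ->]] [q [qE ->]]; exists (p - q); rewrite hornerD hornerN.
  by split=> // i; rewrite coefB; case: fE => _ h _ _; apply: h.
have FM y z : F y -> F z -> F (y * z).
  move=> [p [pE ->]] [q [qE ->]]; exists (p * q); rewrite hornerM.
  by split=> // i; rewrite coefM; apply: fieldE_sum => // j _; exact: fieldE_M.
exists F; split=> //; last first.
  exists 'X; rewrite hornerX; split=> // i; rewrite coefX.
  by case: eqP => _; [exact: fieldE1|exact: fieldE0].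
split=> //; first exact: ring_over_Ql_inv.
have [m [mm mQ mx]] := monic_annihilator x.
have QE : Ql `<=` E by case: fE.
pose d := (size m).-1.
have dE : size m = d.+1 by rewrite prednK // size_poly_gt0 monic_neq0.
(* Euclidean division by m, one leading term at a time *)
have reduce (p : {poly C}) : (forall i, E p`_i) ->
    exists q : {poly C}, [/\ forall i, E q`_i, (size q <= d)%N & q.[x] = p.[x]].
  have [s] := ubnP (size p); elim: s p => // s IH p sp pE.
  have [pd|dp] := leqP (size p) d; first by exists p.
  pose k := (size p - d.+1)%N.
  have m0 : m != 0 := monic_neq0 mm.
  pose q := p - (lead_coef p *: 'X^k) * m.
  have qx : q.[x] = p.[x].
    by rewrite /q hornerD hornerN hornerM (eqP mx) mulr0 subr0.
  rewrite -qx; apply: IH.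
    have p0 : p != 0 by rewrite -size_poly_gt0; apply: leq_trans dp.
    move: sp; rewrite ltnS; apply: leq_trans.
    have sz : size ((lead_coef p *: 'X^k) * m) = size p.
      rewrite -scalerAl size_scale ?lead_coef_eq0 // mulrC size_mulXn // dE.
      by rewrite /k subnK.
    have lc : lead_coef ((lead_coef p *: 'X^k) * m) = lead_coef p.
      rewrite -scalerAl lead_coefZ lead_coef_Mmonic // lead_coefXn.
      by rewrite mulr1.
    rewrite ltn_neqAle; apply/andP; split; last first.
      by rewrite (leq_trans (size_polyD _ _)) // size_polyN sz geq_max leqnn.
    apply/eqP => sq; have : q`_(size p).-1 = 0.
      by rewrite coefB -{2}sz -!lead_coefE lc subrr.
    rewrite -sq -/(lead_coef q) => /eqP; rewrite lead_coef_eq0 => /eqP q0.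
    by move: sq p0; rewrite q0 size_poly0 -size_poly_gt0 => <-.
  move=> i; rewrite coefB -(scalerAl (lead_coef p) 'X^k m) coefZ coefXnM.
  have [_ h _ _] := fE; apply: h => //.
  apply: fieldE_M => //; first exact: pE.
  by case: ifP => _; [exact: fieldE0|exact: QE].
pose ix (k : 'I_#|{: 'I_n * 'I_d}|) : 'I_n * 'I_d := enum_val k.
exists #|{: 'I_n * 'I_d}|, (fun k => e (ix k).1 * x ^+ (ix k).2).
apply/seteqP; split=> y.
  move=> [p [/reduce[q [qE sq <-]] ->]].
  have ca i : exists a : 'I_n -> C, (forall k, Ql (a k)) /\ q`_i = \sum_k a k * e k.
    by have := qE i; rewrite eE.
  have [a aP] := choice ca.
  exists (fun k => a (ix k).2 (ix k).1); split=> [k|].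
    by case: (aP (ix k).2) => + _; apply.
  rewrite (horner_coef_wide _ sq).
  transitivity (\sum_(k : 'I_n * 'I_d) a k.2 k.1 * (e k.1 * x ^+ k.2)).
    rewrite -(pair_bigA _ (fun (i : 'I_n) (j : 'I_d) => a j i * (e i * x ^+ j))) /=.
    rewrite exchange_big /=; apply: eq_bigr => i _; case: (aP i) => _ ->.
    by rewrite mulr_suml; apply: eq_bigr => j _; rewrite mulrA.
  by rewrite (reindex _ (onW_bij _ (enum_val_bij _))).
move=> /= [a [aQ ->]].
exists (\sum_k (a k * e (ix k).1) *: 'X^((ix k).2)); split; last first.
  by rewrite horner_sum; apply: eq_bigr => k _; rewrite hornerZ hornerXn mulrA.
move=> i; rewrite coef_sum; apply: fieldE_sum => // k _; rewrite coefZ coefXn.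
apply: fieldE_M => //; last by case: eqP => _; [exact: fieldE1|exact: fieldE0].
apply: fieldE_M => //; first exact: QE.
rewrite eE; exists (fun i => (i == (ix k).1)%:R); split=> [j|].
  by case: eqP => _; [exact: Ql1|exact: fieldE0 Ql_field].
rewrite (bigD1 (ix k).1) //= eqxx mul1r big1 ?addr0 // => j /negPf ->.
by rewrite mul0r.
Qed.

(** Adjoin to E the members of a basis of F, one after the other. *)
Lemma finite_ext_compositum E F : finite_ext_Ql E -> finite_ext_Ql F ->
  exists K, [/\ finite_ext_Ql K, E `<=` K & F `<=` K].
Proof.
move=> hE [_ _ _ _ [n [f ->]]].
suff [K [hK EK fK]] : exists K, [/\ finite_ext_Ql K, E `<=` K & forall i, K (f i)].
  exists K; split=> // _ [a [aQ ->]]; have kK := finite_ext_field hK.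
  by apply: fieldE_sum => // i _; apply: fieldE_M => //; case: kK => + _ _ _; apply.
elim: n f => [|n IH] f; first by exists E; split=> // -[].
have [K [hK EK fK]] := IH (fun i => f (lift ord0 i)).
have [L [hL KL Lx]] := adjoin_finite_ext (f ord0) hK.
exists L; split=> //; first exact: subset_trans EK KL.
by move=> i; case: (unliftP ord0 i) => [j|] ->; [apply: KL; exact: fK|].
Qed.

Lemma finite_ext_big (I : finType) (E : I -> set C) :
  (forall i, finite_ext_Ql (E i)) ->
  exists K, finite_ext_Ql K /\ forall i, E i `<=` K.
Proof.
move=> hE; suff [K [hK EK]] : exists K, finite_ext_Ql K /\
    forall i, i \in enum I -> E i `<=` K.
  by exists K; split=> // i; apply: EK; rewrite mem_enum.
elim: (enum I) => [|i s [K [hK EK]]]; first by exists Ql; split=> //; exact: Ql_finite_ext.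
have [L [hL iL KL]] := finite_ext_compositum (hE i) hK.
exists L; split=> // j; rewrite inE => /predU1P[->|/EK jK] //.
exact: subset_trans jK KL.
Qed.

End FiniteExtensions.

(** * Admissible functions *)

Section AdmissibleFunctions.
Variables (l : nat) (C : qlbarType l) (T : topologicalType) (A : set T).
Implicit Types f g h : T -> C.

Lemma adm_funP f : admissible_fun A f <->
  (forall x, A x -> f @ within A (nbhs x) --> f x) /\
  exists2 E, finite_ext_Ql E & forall x, A x -> E (f x).
Proof. by split=> -[h hE]; split=> //; apply/subspace_continuousP. Qed.

Lemma adm_cvg f x : admissible_fun A f -> A x -> f @ within A (nbhs x) --> f x.
Proof. by move=> /adm_funP[h _]; apply: h. Qed.

Lemma adm_near_neq0 f x : admissible_fun A f -> A x -> f x != 0 ->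
  \forall y \near within A (nbhs x), f y != 0.
Proof. by move=> af Ax fx; apply: near_neq0 fx (adm_cvg af Ax). Qed.

(** The device by which scalars extracted from proportional operators are shown
    to be admissible: near each point f is the quotient h k / g k for some k,
    and its values lie in a field that contains those of all g k and h k. *)
Lemma adm_quotient (K : finType) (g h : K -> T -> C) f :
  (forall k, admissible_fun A (g k)) -> (forall k, admissible_fun A (h k)) ->
  (forall k x, A x -> f x * g k x = h k x) ->
  (forall x, A x -> exists k, g k x != 0) -> admissible_fun A f.
Proof.
move=> ag ah fg g0; apply/adm_funP; split.
  move=> x Ax; have [k gk0] := g0 x Ax.
  have fE y : A y -> g k y != 0 -> f y = h k y * (g k y)^-1.
    by move=> Ay gy; rewrite -fg // mulfK.
  have cf : (fun y => h k y * (g k y)^-1) @ within A (nbhs x) --> f x.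
    rewrite (fE x) //.
    by apply: cvgC_M; [|apply: cvgC_V => //]; exact: adm_cvg.
  have := cf; apply: cvg_trans; apply: near_eq_cvg.
  have := adm_near_neq0 (ag k) Ax gk0.
  by rewrite !near_withinE; apply: filterS => y gy Ay; rewrite fE // gy.
have field_of (k : K + K) : exists E, finite_ext_Ql E /\
    forall x, A x -> E (match k with inl k => g k x | inr k => h k x end).
  by case: k => k; [have [_ [E]] := ag k|have [_ [E]] := ah k]; exists E.
have [E hE] := choice field_of.
have [L [hL EL]] := finite_ext_big (fun k => (hE k).1).
exists L => // x Ax; have [k gk0] := g0 x Ax.
have [_ _ _ LV] := finite_ext_field hL.
have -> : f x = h k x * (g k x)^-1 by rewrite -fg // mulfK.
apply: fieldE_M (finite_ext_field hL) _ _ _ _.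
  by apply: (EL (inr k)); apply: (hE (inr k)).2.
by apply: LV; apply: (EL (inl k)); apply: (hE (inl k)).2.
Qed.

Lemma eq_adm f g : (forall x, A x -> f x = g x) ->
  admissible_fun A g -> admissible_fun A f.
Proof.
move=> fg /adm_funP[cg [E hE gE]]; apply/adm_funP; split; last first.
  by exists E => // x Ax; rewrite fg //; apply: gE.
move=> x Ax; rewrite fg //; have := cg x Ax; apply: cvg_trans; apply: near_eq_cvg.
by rewrite near_withinE; apply: nearW => y Ay; rewrite fg.
Qed.

Lemma adm_cst (c : C) : admissible_fun A (fun=> c).
Proof.
apply/adm_funP; split=> [x _|]; first exact: cvg_cst.
have [E [hE _ Ec]] := adjoin_finite_ext c (@Ql_finite_ext l C).
by exists E.
Qed.

Lemma admD f g : admissible_fun A f -> admissible_fun A g ->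
  admissible_fun A (fun x => f x + g x).
Proof.
move=> /adm_funP[cf [E hE fE]] /adm_funP[cg [F hF gF]].
apply/adm_funP; split=> [x Ax|]; first by apply: cvgC_D; [exact: cf|exact: cg].
have [K [hK EK FK]] := finite_ext_compositum hE hF; exists K => // x Ax.
by apply: fieldE_D (finite_ext_field hK) _ _ _ _; [apply/EK/fE|apply/FK/gF].
Qed.

Lemma admM f g : admissible_fun A f -> admissible_fun A g ->
  admissible_fun A (fun x => f x * g x).
Proof.
move=> /adm_funP[cf [E hE fE]] /adm_funP[cg [F hF gF]].
apply/adm_funP; split=> [x Ax|]; first by apply: cvgC_M; [exact: cf|exact: cg].
have [K [hK EK FK]] := finite_ext_compositum hE hF; exists K => // x Ax.
by apply: fieldE_M (finite_ext_field hK) _ _ _ _; [apply/EK/fE|apply/FK/gF].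
Qed.

Lemma adm_sum (I : Type) (r : seq I) (f : I -> T -> C) :
  (forall i, admissible_fun A (f i)) ->
  admissible_fun A (fun x => \sum_(i <- r) f i x).
Proof.
move=> af; elim: r => [|i r IH].
  by apply: eq_adm (adm_cst 0) => x _; rewrite big_nil.
by apply: eq_adm (admD (af i) IH) => x _; rewrite big_cons.
Qed.

Lemma adm_locally_constant (S : set T) :
  (forall x, A x -> \forall y \near within A (nbhs x), `[< S y >] = `[< S x >]) ->
  admissible_fun A (fun x => `[< S x >]%:R : C).
Proof.
move=> Sloc; apply/adm_funP; split=> [x Ax|]; last first.
  exists (@Ql l C); first exact: Ql_finite_ext.
  by move=> x _; case: asboolP => _; [exact: Ql1|exact: fieldE0 (@Ql_field l C)].
apply/cvgCP => N; have := Sloc x Ax; apply: filterS => y ->.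
by rewrite subrr; exact: valn_gt0.
Qed.

End AdmissibleFunctions.

Lemma adm_comp (l : nat) (C : qlbarType l) (S T : topologicalType)
    (A : set T) (B : set S) (f : T -> C) (phi : S -> T) :
  continuous phi -> (forall x, B x -> A (phi x)) ->
  admissible_fun A f -> admissible_fun B (fun x => f (phi x)).
Proof.
move=> cphi BA /adm_funP[cf [E hE fE]]; apply/adm_funP; split; last first.
  by exists E => // x Bx; apply/fE/BA.
move=> x Bx; apply: cvg_trans (cf _ (BA _ Bx)).
move=> U; rewrite /nbhs /= => h; have := cphi x _ h.
by rewrite /nbhs /=; apply: filterS => y /= hy By; apply/hy/BA.
Qed.

(** * Admissible functions with values in vector spaces *)

Lemma linear_lfun (K : fieldType) (X Y : vectType K) (f : X -> Y) :
  linear f -> exists F : 'Hom(X, Y), forall x, F x = f x.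
Proof.
move=> f_lin; pose fL := GRing.isLinear.Build _ _ _ _ f f_lin.
pose g : {linear X -> Y} := HB.pack f fL.
by exists (linfun g) => x; rewrite lfunE.
Qed.

Lemma compress_lfun (K : fieldType) (X Y V : vectType K) (p : 'Hom(V, Y))
    (s : 'Hom(X, V)) :
  exists F : 'Hom('End(V), 'Hom(X, Y)), forall f, F f = (p \o f \o s)%VF.
Proof.
apply: linear_lfun => k f g.
by rewrite comp_lfunDr comp_lfunDl -comp_lfunZr -comp_lfunZl.
Qed.

Section AdmissibleVectors.
Variables (l : nat) (C : qlbarType l) (T : topologicalType) (A : set T).
Implicit Types X Y Z : vectType C.

(** Admissibility of a function with values in a finite dimensional space,
    without reference to a basis. *)
Definition adm_vec X (f : T -> X) :=
  forall L : 'Hom(X, C^o), admissible_fun A (fun x => L (f x) : C).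

Lemma adm_vec_lin X Y (f : T -> X) (F : 'Hom(X, Y)) :
  adm_vec f -> adm_vec (fun x => F (f x)).
Proof.
by move=> af L; apply: eq_adm (af (L \o F)%VF) => x _; rewrite comp_lfunE.
Qed.

Lemma eq_adm_vec X (f g : T -> X) : (forall x, A x -> f x = g x) ->
  adm_vec g -> adm_vec f.
Proof. by move=> fg ag L; apply: eq_adm (ag L) => x Ax; rewrite fg. Qed.

Lemma adm_vec_sum X (I : Type) (r : seq I) (f : I -> T -> X) :
  (forall i, adm_vec (f i)) -> adm_vec (fun x => \sum_(i <- r) f i x).
Proof.
move=> af L; apply: eq_adm (adm_sum r (fun i => af i L)) => x _.
by rewrite linear_sum.
Qed.

Lemma adm_vecZ X (c : T -> C) (f : T -> X) :
  admissible_fun A c -> adm_vec f -> adm_vec (fun x => c x *: f x).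
Proof.
by move=> ac af L; apply: eq_adm (admM ac (af L)) => x _; rewrite linearZ.
Qed.

Lemma adm_vec_cst X (v : X) : adm_vec (fun=> v).
Proof. by move=> L; apply: adm_cst. Qed.

Lemma coord_lfun X n (b : n.-tuple X) (i : 'I_n) :
  exists L : 'Hom(X, C^o), forall v, L v = coord b i v.
Proof. by apply: (linear_lfun (Y := C^o)) => k u v; rewrite linearP. Qed.

Lemma adm_vec_coord X n (b : n.-tuple X) (i : 'I_n) (f : T -> X) :
  adm_vec f -> admissible_fun A (fun x => coord b i (f x)).
Proof.
move=> af; have [L LE] := coord_lfun b i.
by apply: eq_adm (af L) => x _; rewrite LE.
Qed.

(** Expand both arguments in bases: B (f x) (g x) is a combination of constant
    vectors whose coefficients are products of coordinates. *)
Lemma adm_vec_bilinear X Y Z (B : X -> Y -> Z) (f : T -> X) (g : T -> Y) :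
  (forall y, linear (B^~ y)) -> (forall x, linear (B x)) ->
  adm_vec f -> adm_vec g -> adm_vec (fun x => B (f x) (g x)).
Proof.
move=> Bl Br af ag; pose bX := vbasis {:X}; pose bY := vbasis {:Y}.
have BE x : B (f x) (g x) = \sum_i \sum_j
    (coord bX i (f x) * coord bY j (g x)) *: B bX`_i bY`_j.
  have [F FE] := linear_lfun (Bl (g x)).
  transitivity (F (f x)); first by rewrite FE.
  rewrite {1}(coord_vbasis (memvf (f x))) linear_sum; apply: eq_bigr => i _.
  have [G GE] := linear_lfun (Br bX`_i).
  rewrite linearZ /= FE; transitivity (coord bX i (f x) *: G (g x)).
    by rewrite GE.
  rewrite {1}(coord_vbasis (memvf (g x))) linear_sum scaler_sumr.
  by apply: eq_bigr => j _; rewrite linearZ /= GE scalerA.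
apply: (@eq_adm_vec _ _ (fun x => \sum_i \sum_j
    (coord bX i (f x) * coord bY j (g x)) *: B bX`_i bY`_j)) => //.
apply: adm_vec_sum => i; apply: adm_vec_sum => j; apply: adm_vecZ.
  by apply: admM; apply: adm_vec_coord.
exact: adm_vec_cst.
Qed.

Lemma adm_vec_comp X Y Z (f : T -> 'Hom(Y, Z)) (g : T -> 'Hom(X, Y)) :
  adm_vec f -> adm_vec g -> adm_vec (fun x => (f x \o g x)%VF).
Proof.
apply: adm_vec_bilinear => [y k u v|x k u v].
  by rewrite comp_lfunDl comp_lfunZl.
by rewrite comp_lfunDr comp_lfunZr.
Qed.

Lemma adm_vec_near_neq0 X (f : T -> X) x : adm_vec f -> A x -> f x != 0 ->
  \forall y \near within A (nbhs x), f y != 0.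
Proof.
move=> af Ax fx.
have [i ci] : exists i, coord (vbasis {:X}) i (f x) != 0.
  apply/existsP; apply: contraNT fx; rewrite negb_exists => /forallP c0.
  rewrite (coord_vbasis (memvf (f x))) big1 // => i _.
  by have := c0 i; rewrite negbK => /eqP ->; rewrite scale0r.
have := adm_near_neq0 (adm_vec_coord (vbasis {:X}) i af) Ax ci.
by apply: filterS => y; apply: contraNneq => ->; rewrite linear0.
Qed.

(** The definition by means of an E-form does not depend on the basis, because a
    change of basis has finitely many coefficients and these generate a finite
    extension. *)
Lemma admissible_autP X (f : T -> 'End(X)) :
  admissible_aut A f <-> (forall x, A x -> bijective (f x)) /\ adm_vec f.
Proof.
split=> [[fbij [E [b [hE bb fE]]]]|[fbij af]]; split=> //.
  pose el (i j : 'I_(\dim {:X})) := fun v : X => coord b j v *: b`_i.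
  have el_lin i j : linear (el i j).
    by move=> k u v; rewrite /el linearP scalerDl scalerA.
  have [F FE] := choice (fun ij : _ * _ => linear_lfun (el_lin ij.1 ij.2)).
  have fsum x : f x = \sum_i \sum_(j < \dim {:X}) coord b i (f x b`_j) *: F (i, j).
    apply/lfunP => v; rewrite sum_lfunE.
    rewrite {1}(coord_basis bb (memvf (f x v))); apply: eq_bigr => i _.
    rewrite sum_lfunE {1}(coord_basis bb (memvf v)) !linear_sum scaler_suml.
    apply: eq_bigr => j _.
    by rewrite scale_lfunE FE /el !linearZ /= scalerA mulrC.
  apply: eq_adm_vec (fun x _ => fsum x) _.
  apply: adm_vec_sum => i; apply: adm_vec_sum => j; apply: adm_vecZ; last first.
    exact: adm_vec_cst.
  by split; [case: (fE i j)|exists E => // x Ax; case: (fE i j) => + _; apply].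
pose b := vbasis {:X}.
have ac (ij : 'I_(\dim {:X}) * 'I_(\dim {:X})) :
    admissible_fun A (fun x => coord b ij.1 (f x b`_ij.2)).
  have [L LE] : exists L : 'Hom('End(X), X), forall g, L g = g b`_ij.2.
    by apply: linear_lfun => k u v; rewrite lfunE /= lfunE.
  by apply: eq_adm (adm_vec_coord b ij.1 (adm_vec_lin L af)) => x _; rewrite LE.
have field_of (ij : 'I_(\dim {:X}) * 'I_(\dim {:X})) : exists E, finite_ext_Ql E /\
    forall x, A x -> E (coord b ij.1 (f x b`_ij.2)).
  by have [_ [E hE h]] := ac ij; exists E.
have [E hE] := choice field_of.
have [K [hK EK]] := finite_ext_big (fun ij => (hE ij).1).
exists K, b; split=> //; first exact: vbasisP.
move=> i j; split; last by have [] := ac (i, j).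
by move=> x Ax; apply: (EK (i, j)); apply: (hE (i, j)).2.
Qed.

End AdmissibleVectors.

(** * Finiteness *)

(** Finiteness is always shown below by exhibiting finitely many data d that
    determine f. *)
Lemma finite_image_factor (X Y Z : Type) (A : set X) (f : X -> Y) (d : X -> Z) :
  finite_set [set d x | x in A] ->
  (forall x y, A x -> A y -> d x = d y -> f x = f y) ->
  finite_set [set f x | x in A].
Proof.
move=> fd df; have [->|/set0P[x0 Ax0]] := eqVneq A set0.
  by rewrite image_set0.
have hP z : exists y, forall x, A x -> d x = z -> f x = y.
  have [[x [Ax dx]]|nx] := pselect (exists x, A x /\ d x = z).
    by exists (f x) => y Ay dy; apply: df => //; rewrite dx.
  by exists (f x0) => y Ay dy; case: nx; exists y.
have [h hE] := choice hP.
apply: sub_finite_set _ (finite_image h fd) => _ [x Ax <-].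
by exists (d x); [exists x|rewrite -(hE (d x) x)].
Qed.

Lemma finite_image_map (X Y : Type) (K : Type) (A : set X) (d : K -> X -> Y)
    (s : seq K) :
  (forall k, finite_set [set d k x | x in A]) ->
  finite_set [set [seq d k x | k <- s] | x in A].
Proof.
move=> fd; elim: s => [|k s IH] /=.
  by apply: (sub_finite_set _ (finite_set1 ([::] : seq Y))) => _ [x _ <-].
apply: (sub_finite_set _ (finite_image2 cons (fd k) IH)) => _ [x Ax <-].
by exists (d k x); [exists x|exists [seq d k x | k <- s]; [exists x|]].
Qed.

(** * Subgroups of finite index *)

Lemma multiplicative1 (G H : groupType) (f : {multiplicative G -> H}) : f 1%g = 1%g.
Proof. by apply: (mulgI (f 1%g)); rewrite -gmulfM !mulg1. Qed.

Lemma multiplicativeV (G H : groupType) (f : {multiplicative G -> H}) x :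
  f x^-1%g = (f x)^-1%g.
Proof. by apply: (mulgI (f x)); rewrite -gmulfM !mulgV multiplicative1. Qed.

Section Cosets.
Variables (G : groupType) (H : set G).
Hypothesis Hsub : is_subgroup H.
Local Open Scope group_scope.

Lemma subgroup1 : H 1. Proof. by case: Hsub. Qed.
Lemma subgroupM x y : H x -> H y -> H (x * y). Proof. by case: Hsub => _ + _; apply. Qed.
Lemma subgroupV x : H x -> H x^-1. Proof. by case: Hsub => _ _; apply. Qed.

Lemma lcoset_eqP x y : lcoset_set H x = lcoset_set H y <-> H (x^-1 * y).
Proof.
split=> [e|h].
  have [z Hz ex] : lcoset_set H x y.
    by rewrite e; exists 1; [exact: subgroup1|rewrite mulg1].
  by rewrite -ex mulKg.
apply/seteqP; split=> _ [z Hz <-].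
  exists (y^-1 * (x * z)); last by rewrite mulVKg.
  by rewrite mulgA; apply: subgroupM => //; rewrite -[y^-1 * x]invgK invgM invgK;
    exact: subgroupV.
exists (x^-1 * (y * z)); last by rewrite mulVKg.
by rewrite mulgA; apply: subgroupM.
Qed.

Lemma finite_index_factor (Z : Type) (d : G -> Z) :
  finite_set (range d) -> (forall x y, d x = d y -> H (x^-1 * y)) ->
  finite_index H.
Proof.
move=> fd dH; apply: finite_image_factor fd _ => x y _ _ /dH.
by move/lcoset_eqP.
Qed.

Lemma transversal_ex : finite_index H ->
  exists n (r : 'I_n -> G), forall x, exists k,
    H ((r k)^-1 * x) /\ forall k', H ((r k')^-1 * x) -> k' = k.
Proof.
move=> /finite_seqP[s0 sE]; pose s := undup s0.
have rep c : exists x, c \in s -> c = lcoset_set H x.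
  have [cs|cs] := boolP (c \in s); last by exists 1.
  have : [set` s0] c by rewrite /= -mem_undup.
  by rewrite -sE => -[x _ <-]; exists x.
have [f fE] := choice rep.
have sP x : lcoset_set H x \in s.
  rewrite mem_undup; have : [set lcoset_set H x | x in [set: G]] (lcoset_set H x).
    by exists x.
  by rewrite sE.
exists (size s), (fun k => f (nth set0 s k)) => x.
have rP (k : 'I_(size s)) : H ((f (nth set0 s k))^-1 * x) ->
    nth set0 s k = lcoset_set H x.
  by move/lcoset_eqP <-; apply: fE; apply: mem_nth.
have ix : (index (lcoset_set H x) s < size s)%N by rewrite index_mem.
exists (Ordinal ix); split.
  by apply/lcoset_eqP; rewrite -fE /= nth_index // sP.
move=> k /rP ek; apply: val_inj => /=.
by rewrite -ek index_uniq // undup_uniq.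
Qed.

End Cosets.

Lemma preimage_subgroup (G G' : groupType) (f : {multiplicative G -> G'})
    (H : set G') : is_subgroup H -> is_subgroup (f @^-1` H).
Proof.
move=> Hs; split=> [|x y|x]; rewrite /preimage /= ?multiplicative1 ?gmulfM
  ?multiplicativeV.
- exact: subgroup1.
- exact: subgroupM.
- exact: subgroupV.
Qed.

Lemma preimage_finite_index (G G' : groupType) (f : {multiplicative G -> G'})
    (H : set G') : is_subgroup H -> finite_index H -> finite_index (f @^-1` H).
Proof.
move=> Hs Hfin.
apply: (finite_index_factor (preimage_subgroup f Hs)
  (d := fun x => lcoset_set H (f x))).
  by apply: sub_finite_set _ Hfin => _ [x _ <-]; exists (f x).
by move=> x y /(lcoset_eqP Hs); rewrite /preimage /= gmulfM multiplicativeV.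
Qed.

(** * Topological groups *)

Section TopologicalGroups.
Local Open Scope group_scope.

Lemma mulgl_continuous (Q : topGroupType) (a : Q) : continuous (fun x : Q => a * x).
Proof.
move=> x; apply: (@continuous_comp _ _ _ (fun x => (a, x)) (fun p : Q * Q => p.1 * p.2)).
  by apply: cvg_pair; [exact: cvg_cst|exact: cvg_id].
exact: mulg_continuous.
Qed.

Lemma mulgr_continuous (Q : topGroupType) (a : Q) : continuous (fun x : Q => x * a).
Proof.
move=> x; apply: (@continuous_comp _ _ _ (fun x => (x, a)) (fun p : Q * Q => p.1 * p.2)).
  by apply: cvg_pair; [exact: cvg_id|exact: cvg_cst].
exact: mulg_continuous.
Qed.

(** By compactness, finitely many translates of W cover Q. *)
Lemma open_finite_cosets (Q : topGroupType) (W : set Q) :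
  compact [set: Q] -> open W -> W 1 ->
  exists s : seq Q, forall q, exists2 z, z \in s & W (z^-1 * q).
Proof.
move=> cQ oW W1.
(* 1 is the base point that the covering property asks for *)
pose Qp : ptopologicalType := HB.pack (TopologicalGroup.sort Q) (isPointed.Build Q 1).
have {}cQ : @cover_compact Qp [set: Q] by rewrite -compact_cover.
have [| |D _ DQ] := cQ _ [set: Q] (fun z => [set q | W (z^-1 * q)]).
- move=> z _; apply: open_comp oW => x _; exact: mulgl_continuous.
- by move=> q _; exists q => //=; rewrite mulVg.
by exists (finmap.enum_fset D) => q; have [z zD Wz] := DQ q I; exists z.
Qed.

Section Quotient.
Variables (Q G : topGroupType) (N : set Q) (p : {multiplicative Q -> G}).
Hypothesis pQ : is_quotient_by N p.

Lemma quotient_surj g : exists q, p q = g.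
Proof. by case: pQ => + _ _ => /(_ g I)[q _ <-]; exists q. Qed.

Lemma quotient_ker q : p q = 1 <-> N q.
Proof. by case: pQ => _ <- _. Qed.

Lemma quotient_eq q r : p q = p r -> exists2 n, N n & r = q * n.
Proof.
move=> e; exists (q^-1 * r); last by rewrite mulVKg.
by apply/quotient_ker; rewrite gmulfM multiplicativeV e mulVg.
Qed.

(** The saturation of U is the union of its translates by the kernel. *)
Lemma quotient_open_map (U : set Q) : open U -> open [set p q | q in U].
Proof.
case: (pQ) => _ _ pO oU; apply/pO.
have -> : p @^-1` [set p q | q in U] =
    \bigcup_(n in N) [set q | U (q * n^-1)].
  apply/seteqP; split=> [x [u Uu /quotient_eq[n Nn ->]]|x [n Nn /= Ux]].
    by exists n => //=; rewrite mulgK.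
  exists (x * n^-1) => //; rewrite gmulfM multiplicativeV.
  by move/quotient_ker: Nn => ->; rewrite invg1 mulg1.
apply: bigcup_open => n _; apply: open_comp oU => x _; exact: mulgr_continuous.
Qed.

Lemma quotient_nbhs q (U : set Q) : nbhs q U -> nbhs (p q) [set p x | x in U].
Proof.
rewrite nbhsE => -[V [oV Vq] VU]; rewrite nbhsE.
exists [set p x | x in V]; last exact: image_subset.
by split; [exact: quotient_open_map|exists q].
Qed.

End Quotient.

(** An open surjection maps neighbourhoods onto neighbourhoods, so continuity can
    be tested upstairs.  This is how functions on G are handled through Q. *)
Lemma adm_descend (l : nat) (C : qlbarType l) (S T : topologicalType)
    (phi : S -> T) (A : set T) (f : T -> C) :
  (forall x U, nbhs x U -> nbhs (phi x) [set phi y | y in U]) ->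
  (forall t, exists x, phi x = t) ->
  admissible_fun (phi @^-1` A) (fun x => f (phi x)) -> admissible_fun A f.
Proof.
move=> nphi sphi /adm_funP[cf [E hE fE]]; apply/adm_funP; split; last first.
  exists E => // t; have [x <-] := sphi t; exact: fE.
move=> t; have [x <-] := sphi t => At U /(cf x At) h.
have := nphi _ _ h; apply: filterS => _ [y hy <-] Ay; exact: hy.
Qed.

Lemma prod_nbhs_image (S T : topologicalType) (phi : S -> T) :
  (forall x U, nbhs x U -> nbhs (phi x) [set phi y | y in U]) ->
  forall (x : S * S) U, nbhs x U ->
    nbhs (phi x.1, phi x.2) [set (phi y.1, phi y.2) | y in U].
Proof.
move=> nphi [x1 x2] U [[A B] [/= Ax Bx] ABU].
exists ([set phi y | y in A], [set phi y | y in B]) => /=.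
  by split; exact: nphi.
by move=> [_ _] [/= [a Aa <-] [b Bb <-]]; exists (a, b) => //; apply: ABU.
Qed.

(** A closed subgroup containing the kernel of p is the preimage of a closed
    subgroup, so it is enough that it meets the preimages of topological
    generators. *)
Lemma closed_subgroup_full (Q G : topGroupType) (N : set Q)
    (p : {multiplicative Q -> G}) (S : set G) (H : set Q) :
  is_quotient_by N p -> closure (generated S) = [set: G] ->
  closed H -> is_subgroup H -> N `<=` H -> S `<=` [set p x | x in H] ->
  H = [set: Q].
Proof.
move=> pQ gS cH Hsub NH SH.
have pK : p @^-1` [set p x | x in H] = H.
  apply/seteqP; split=> [x [y Hy /(quotient_eq pQ)[n Nn ->]]|x Hx]; last by exists x.
  by apply: subgroupM => //; apply: NH.
have pHc : closed [set p x | x in H].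
  rewrite -openC; case: (pQ) => _ _ pO; apply/pO.
  by rewrite -preimage_setC pK openC.
have pHs : is_subgroup [set p x | x in H].
  split=> [|_ _ [x Hx <-] [y Hy <-]|_ [x Hx <-]].
  - by exists 1; [exact: subgroup1|rewrite multiplicative1].
  - by exists (x * y); [exact: subgroupM|rewrite gmulfM].
  - by exists x^-1; [exact: subgroupV|rewrite multiplicativeV].
rewrite -pK -(preimage_setT p); congr (p @^-1` _).
apply/seteqP; split=> // g _; rewrite ((closure_id _).1 pHc).
move: (I : [set: G] g); rewrite -gS; apply: closure_subset.
by move=> x; apply.
Qed.

End TopologicalGroups.

(** * Schur's lemma and semisimple actions *)

Import passmx.

Lemma irreducible_nonzero (K : fieldType) (X : vectType K) (I : Type)
    (e : I -> 'End(X)) : irreducible_under e fullv -> exists u : X, u != 0.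
Proof.
move=> [_ X0 _]; apply: contrapT => nz; apply: X0; apply/eqP.
rewrite -subv0; apply/subvP => u _; rewrite memv0; apply: contrapT => /negP u0.
by apply: nz; exists u.
Qed.

Lemma irreducible_id_neq0 (K : fieldType) (X : vectType K) (I : Type)
    (e : I -> 'End(X)) : irreducible_under e fullv -> \1%VF != 0 :> 'End(X).
Proof.
move=> /irreducible_nonzero[u u0]; apply: contraNneq u0 => /lfunP/(_ u).
by rewrite id_lfunE zero_lfunE => ->.
Qed.

Section Schur.
Variables (K : closedFieldType) (X Y : vectType K) (I I' : Type).
Variables (e : I -> 'End(X)) (d : I' -> 'End(Y)) (R : I -> I' -> Prop).

(** The relation R generalises the usual case of one acting set: below it is
    conjugation by an element of Q, which relates I to itself. *)
Definition intertwines (f : 'Hom(X, Y)) :=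
  forall x y, R x y -> (f \o e x)%VF = (d y \o f)%VF.

Lemma lfun_eigenvalue (f : 'End(X)) : {:X}%VS <> 0%VS ->
  exists c v, v != 0 /\ f v = c *: v.
Proof.
move=> X0; set b := vbasis {:X}; have bb : basis_of {:X} b := vbasisP _.
pose A := mxof b b f.
have sz : size (char_poly A) != 1%N.
  by rewrite size_char_poly eqSS dimv_eq0; apply/eqP.
have [c rc] := closed_rootP _ sz.
have /eigenvalueP[u uA u0] : eigenvalue A c by rewrite eigenvalue_root_char.
exists c, (vecof b u); split.
  apply: contraNneq u0 => u0; apply/eqP.
  by rewrite -(vecofK bb u) u0 linear0.
by rewrite (hom_vecof b bb) uA linearZ.
Qed.

(** The kernel and the image of f are stable since R is total on both sides. *)
Lemma intertwines_bij (f : 'Hom(X, Y)) :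
  irreducible_under e fullv -> irreducible_under d fullv ->
  (forall x, exists y, R x y) -> (forall y, exists x, R x y) ->
  intertwines f -> f != 0 -> exists g, (g \o f)%VF = \1%VF /\ (f \o g)%VF = \1%VF.
Proof.
move=> [_ _ irrX] [_ _ irrY] Rl Rr fR f0.
have ker0 : lker f = 0%VS.
  case: (irrX (lker f)) => [x||//|kf]; [|exact: subvf|].
    have [y Rxy] := Rl x; apply/subvP => _ /memv_imgP[u + ->].
    rewrite !memv_ker -comp_lfunE (fR _ _ Rxy) comp_lfunE => /eqP ->.
    by rewrite linear0.
  case/eqP: f0; apply/lfunP => u; rewrite lfunE /=; apply/eqP.
  by rewrite -memv_ker kf memvf.
have limf : limg f = fullv.
  case: (irrY (limg f)) => [y||f_0|//]; [|exact: subvf|].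
    have [x Rxy] := Rr y; apply/subvP => _ /memv_imgP[_ /memv_imgP[u _ ->] ->].
    by rewrite -comp_lfunE -(fR _ _ Rxy) comp_lfunE memv_img ?memvf.
  case/eqP: f0; apply/lfunP => u; rewrite lfunE /=; apply/eqP.
  by rewrite -memv0 -f_0 memv_img ?memvf.
exists f^-1%VF; split; first by rewrite lker0_compVf // ker0.
by apply/lfunP => v; rewrite comp_lfunE lfunE /= limg_lfunVK // limf memvf.
Qed.

(** With g inverse to f and c an eigenvalue of g f', the intertwiner f' - c f is
    not injective, hence vanishes. *)
Lemma intertwines_scale (f f' : 'Hom(X, Y)) :
  irreducible_under e fullv -> irreducible_under d fullv ->
  (forall x, exists y, R x y) -> (forall y, exists x, R x y) ->
  intertwines f -> intertwines f' -> f != 0 -> exists c, f' = c *: f.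
Proof.
move=> irrX irrY Rl Rr fR fR' f0.
have [g [gf fg]] := intertwines_bij irrX irrY Rl Rr fR f0.
have [_ X0 _] := irrX; have [c [v [v0 cv]]] := lfun_eigenvalue (g \o f')%VF X0.
exists c; apply/eqP; rewrite -subr_eq0; apply: contraNT v0 => h0.
have hR : intertwines (f' - c *: f).
  move=> x y Rxy; rewrite comp_lfunDl comp_lfunDr comp_lfunNl comp_lfunNr.
  by rewrite -comp_lfunZl -comp_lfunZr (fR _ _ Rxy) (fR' _ _ Rxy).
have [h [hf _]] := intertwines_bij irrX irrY Rl Rr hR h0.
have f'v : f' v = c *: f v.
  by rewrite -[f' v]id_lfunE -fg comp_lfunE -[g _]comp_lfunE cv linearZ.
have hv : v = h ((f' - c *: f) v) by rewrite -comp_lfunE hf id_lfunE.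
by rewrite hv add_lfunE opp_lfunE scale_lfunE f'v subrr linear0.
Qed.

End Schur.

(** Inclusions and projections of a decomposition, instead of subspaces, let
    the components be types of their own and turn all statements about them
    into identities between linear maps. *)
Lemma semisimple_split (K : fieldType) (V : vectType K) (I : Type)
    (f : I -> 'End(V)) : semisimple f ->
  exists n (E : 'I_n -> vectType K) (s : forall i, 'Hom(E i, V))
         (p : forall i, 'Hom(V, E i)),
    [/\ forall i, (p i \o s i)%VF = \1%VF,
        forall i j, i != j -> (p i \o s j)%VF = 0,
        \sum_i (s i \o p i)%VF = \1%VF,
        forall i x, (f x \o s i)%VF = (s i \o (p i \o f x \o s i))%VF &
        forall i, irreducible_under (fun x => p i \o f x \o s i)%VF fullv].
Proof.
move=> [n [U [irrU dU sU]]].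
pose E i : vectType K := subvs_of (U i).
pose s i : 'Hom(E i, V) := linfun vsval.
pose q i := sumv_pi_for (erefl (\sum_i U i)%VS) i.
pose p i : 'Hom(V, E i) := (linfun (vsproj (U i)) \o q i)%VF.
have sE i u : s i u = vsval u by rewrite lfunE.
have qU i v : q i v \in U i by exact: memv_sum_pi.
have qsum v : \sum_i q i v = v by apply: sumv_pi_sum; rewrite sU memvf.
have spE i v : s i (p i v) = q i v by rewrite sE comp_lfunE lfunE /= vsprojK.
have qE i j u : u \in U j -> q i u = if i == j then u else 0.
  move=> uj; have /directv_sum_unique/(_ (fun k => q k u)
    (fun k => if k == j then u else 0)) := dU.
  rewrite qsum => h; have := h (fun k _ => qU k u).
  have -> : \sum_k (if k == j then u else 0) = u by rewrite -big_mkcond big_pred1_eq.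
  rewrite eqxx => /(_ _)/esym/forall_inP h'.
  by apply/eqP; apply: h' => // k _; case: eqP => [->|]; rewrite ?mem0v.
have sinj i : injective (s i) by move=> u v; rewrite !sE => /val_inj.
have psi i u : p i (s i u) = u.
  by apply: sinj; rewrite spE sE (qE i i) ?subvsP // eqxx.
have fs i x u : f x (s i u) \in U i.
  have [/(_ x) /subvP h _ _] := irrU i; apply: h; rewrite memv_img // sE.
  exact: subvsP.
have fsE i x u : f x (s i u) = s i (p i (f x (s i u))).
  by rewrite spE (qE i i) ?fs // eqxx.
exists n, E, s, p; split.
- by move=> i; apply/lfunP => u; rewrite comp_lfunE id_lfunE psi.
- move=> i j ij; apply/lfunP => u; rewrite comp_lfunE zero_lfunE.
  by apply: sinj; rewrite spE linear0 (qE i j) ?(negPf ij) // sE subvsP.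
- apply/lfunP => v; rewrite sum_lfunE id_lfunE -[RHS]qsum.
  by apply: eq_bigr => i _; rewrite comp_lfunE spE.
- by move=> i x; apply/lfunP => u; rewrite [RHS]comp_lfunE 3!comp_lfunE -fsE.
move=> i; have [stU nzU irr] := irrU i.
split=> [x||W stW _]; first exact: subvf.
  move=> E0; apply: nzU; apply/eqP; rewrite -subv0; apply/subvP => u uU.
  have := memvf (vsproj (U i) u); rewrite E0 => /[!memv0]/eqP e0.
  by rewrite -(vsprojK uU) e0 linear0.
case: (irr (s i @: W)%VS) => [x|||].
- apply/subvP => _ /memv_imgP[_ /memv_imgP[u uW ->] ->].
  rewrite fsE; apply: memv_img; have /subvP := stW x; apply.
  by apply/memv_imgP; exists u; rewrite ?comp_lfunE.
- by apply/subvP => _ /memv_imgP[u uW ->]; rewrite sE subvsP.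
- move=> W0; left; apply/eqP; rewrite -subv0; apply/subvP => u uW.
  have : s i u \in (s i @: W)%VS by apply: memv_img.
  by rewrite W0 !memv0 -(linear0 (s i)) (inj_eq (@sinj i)).
move=> WU; right; apply/eqP; rewrite eqEsubv subvf; apply/subvP => u _.
have : s i u \in (s i @: W)%VS by rewrite WU sE subvsP.
by move=> /memv_imgP[v vW /sinj ->].
Qed.

(** * Conjugation of the irreducible components *)

Section Clifford.
Variables (K : closedFieldType) (Q I : groupType) (iota : I -> Q).
Variables (V : vectType K) (rho : Q -> 'End(V)) (m : Q -> Q -> K).
Hypothesis rhoM : forall q r, (rho q \o rho r)%VF = m q r *: rho (q * r)%g.
Hypothesis m0 : forall q r, m q r != 0.
Hypothesis mI : forall q x, m q (iota x) = 1 /\ m (iota x) q = 1.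
Hypothesis rho1 : rho 1%g = \1%VF.
Hypothesis nl : forall q x, exists y, (q * iota x = iota y * q)%g.
Hypothesis nr : forall q y, exists x, (q * iota x = iota y * q)%g.

Variables (n : nat) (E : 'I_n -> vectType K).
Variables (s : forall i, 'Hom(E i, V)) (p : forall i, 'Hom(V, E i)).
Hypothesis ps1 : forall i, (p i \o s i)%VF = \1%VF.
Hypothesis ps0 : forall i j, i != j -> (p i \o s j)%VF = 0.
Hypothesis sp1 : \sum_i (s i \o p i)%VF = \1%VF.

Variable e : forall i, I -> 'End(E i).
Hypothesis rho_s : forall i x, (rho (iota x) \o s i)%VF = (s i \o e i x)%VF.
Hypothesis irr : forall i, irreducible_under (e i) fullv.

Lemma sum_components v : \sum_i s i (p i v) = v.
Proof.
rewrite -[RHS]id_lfunE -sp1 sum_lfunE; apply: eq_bigr => i _.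
by rewrite comp_lfunE.
Qed.

Lemma component_act i x : e i x = (p i \o rho (iota x) \o s i)%VF.
Proof. by rewrite -comp_lfunA rho_s comp_lfunA ps1 comp_lfun1l. Qed.

Lemma rho_p i x : (p i \o rho (iota x))%VF = (e i x \o p i)%VF.
Proof.
apply/lfunP => v; rewrite !comp_lfunE -{1}[v]sum_components !linear_sum.
rewrite (bigD1 i) //= big1 ?addr0; first by rewrite component_act !comp_lfunE.
move=> j ij; have /lfunP/(_ (p j v)) := rho_s j x; rewrite !comp_lfunE => ->.
have ji : i != j by rewrite eq_sym.
have /lfunP := ps0 ji => /(_ (e j x (p j v))).
by rewrite comp_lfunE zero_lfunE.
Qed.

Lemma rho_inj q v : rho q v = 0 -> v = 0.
Proof.
move=> qv; have := rhoM q^-1%g q; rewrite mulVg rho1.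
move/lfunP/(_ v); rewrite comp_lfunE qv linear0 scale_lfunE id_lfunE => /esym/eqP.
by rewrite scaler_eq0 (negPf (m0 _ _)) => /eqP.
Qed.

Lemma s_inj i u : s i u = 0 -> u = 0.
Proof. by move=> su; rewrite -[u]id_lfunE -ps1 comp_lfunE su linear0. Qed.

(** Homomorphisms to E k from the conjugate of E i by q.  The relation between x
    and its conjugate y is used instead of a conjugation map on I, as the latter
    is only defined through the embedding of I in Q. *)
Definition twisted_hom q i k := intertwines (e i) (e k) (fun x y => q * iota x = iota y * q)%g.

(** By Schur's lemma nonzero homomorphisms are isomorphisms: q maps the class of
    E i to that of E k. *)
Definition conj_iso q i k := exists f : 'Hom(E i, E k), twisted_hom q f /\ f != 0.

Lemma twisted_hom_component q i k : twisted_hom q (p k \o rho q \o s i)%VF.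
Proof.
move=> x y qxy; have qx : (rho q \o rho (iota x))%VF = (rho (iota y) \o rho q)%VF.
  by rewrite !rhoM qxy; have [-> _] := mI q x; have [_ ->] := mI q y.
by rewrite -comp_lfunA -rho_s comp_lfunA -(comp_lfunA _ (rho q)) qx comp_lfunA
  rho_p !comp_lfunA.
Qed.

Lemma component_conj_iso q i k : (p k \o rho q \o s i)%VF != 0 -> conj_iso q i k.
Proof. by exists (p k \o rho q \o s i)%VF; split=> //; exact: twisted_hom_component. Qed.

(** As rho q is invertible, it cannot vanish on E i. *)
Lemma component_ex q i : exists k, (p k \o rho q \o s i)%VF != 0.
Proof.
apply: contrapT => nz; have [u u0] := irreducible_nonzero (irr i); case/negP: u0; apply/eqP.
apply: s_inj; apply: (@rho_inj q); rewrite -[LHS]id_lfunE -sp1 sum_lfunE big1 // => k _.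
rewrite comp_lfunE; have [|z] := eqVneq (p k \o rho q \o s i)%VF 0; last by case: nz; exists k.
by move/lfunP/(_ u); rewrite !comp_lfunE zero_lfunE => ->; rewrite linear0.
Qed.

Lemma twisted_hom_bij q i k (f : 'Hom(E i, E k)) : twisted_hom q f -> f != 0 ->
  exists g : 'Hom(E k, E i),
    [/\ (g \o f)%VF = \1%VF, (f \o g)%VF = \1%VF & twisted_hom q^-1 g].
Proof.
move=> ft f0.
have [g [gf fg]] := intertwines_bij (irr i) (irr k) (nl q) (nr q) ft f0.
exists g; split=> // y x qyx; have qxy : (q * iota x = iota y * q)%g.
  by rewrite -[iota x](mulgVK q) -qyx !mulgA mulgV mul1g.
by rewrite -[LHS]comp_lfun1r -fg -comp_lfunA (comp_lfunA (e k y)) -(ft _ _ qxy)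
  !comp_lfunA gf comp_lfun1l.
Qed.

Lemma conj_iso_inv q i k : conj_iso q i k -> conj_iso q^-1 k i.
Proof.
move=> [f [ft f0]]; have [g [gf fg gt]] := twisted_hom_bij ft f0; exists g; split=> //.
apply: contraNneq (irreducible_id_neq0 (irr i)) => g0.
by rewrite -gf g0 comp_lfun0l.
Qed.

Lemma conj_iso_comp q r i j k :
  conj_iso q i j -> conj_iso r j k -> conj_iso (r * q) i k.
Proof.
move=> [f [ft f0]] [g [gt g0]].
exists (g \o f)%VF; split.
  move=> x z rqx; have [y qxy] := nl q x.
  have ryz : (r * iota y = iota z * r)%g.
    by apply: (mulIg q); rewrite -mulgA -qxy mulgA rqx mulgA.
  by rewrite -comp_lfunA (ft _ _ qxy) comp_lfunA (gt _ _ ryz) comp_lfunA.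
have [h [hg _ _]] := twisted_hom_bij gt g0; apply: contraNneq f0 => gf0.
by rewrite -[f]comp_lfun1l -hg -comp_lfunA gf0 comp_lfun0r.
Qed.

Lemma conj_iso1 i : conj_iso 1 i i.
Proof.
exists \1%VF; split; last exact: irreducible_id_neq0 (irr i).
by move=> x y; rewrite mul1g mulg1 comp_lfun1l comp_lfun1r !component_act => ->.
Qed.

Lemma conj_iso_iota x i : conj_iso (iota x) i i.
Proof.
apply: component_conj_iso; rewrite -comp_lfunA rho_s comp_lfunA ps1 comp_lfun1l.
have [u u0] := irreducible_nonzero (irr i); apply: contraNneq u0 => ex0; apply/eqP.
apply: s_inj; apply: (@rho_inj (iota x)).
by rewrite -comp_lfunE rho_s comp_lfunE ex0 zero_lfunE linear0.
Qed.

Lemma stabilizer_subgroup i : is_subgroup [set q | conj_iso q i i].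
Proof.
split=> [|x y /= hx hy|x hx] /=; first exact: conj_iso1.
  exact: conj_iso_comp hy hx.
exact: conj_iso_inv.
Qed.

(** The right-hand side is visibly an open condition on q.  It holds for q in the
    stabiliser because rho q has a nonzero block from E i to some E k, and E k is
    then isomorphic to the conjugate of E i by q, that is, to E i. *)
Lemma stabilizerE q i : conj_iso q i i <->
  exists2 k, conj_iso 1 i k & (p k \o rho q \o s i)%VF != 0.
Proof.
split=> [hq|[k ik /component_conj_iso hq]].
  have [k qk] := component_ex q i; exists k => //; rewrite -(mulgV q).
  exact: conj_iso_comp (conj_iso_inv hq) (component_conj_iso qk).
by have := conj_iso_comp hq (conj_iso_inv ik); rewrite invg1 mul1g.
Qed.

(** Choosing an isomorphism from E i to each E k in its class identifies the
    isotypic component with a sum of copies of E i itself, so that the blocks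
    P a \o rho q \o S b of an element q of the stabiliser are endomorphisms of a
    single space. *)
Lemma isotypic_ex i : exists N (S : 'I_N -> 'Hom(E i, V)) (P : 'I_N -> 'Hom(V, E i))
    (ix : 'I_N -> 'I_n),
  [/\ forall k, conj_iso 1 i k <-> exists a, ix a = k,
      injective ix,
      forall a, (P a \o S a)%VF = \1%VF,
      forall a, (S a \o P a)%VF = (s (ix a) \o p (ix a))%VF &
      forall a, (exists t : 'Hom(E i, E (ix a)),
                   twisted_hom 1 t /\ S a = (s (ix a) \o t)%VF) /\
                (exists t : 'Hom(E (ix a), E i),
                   twisted_hom 1 t /\ P a = (t \o p (ix a))%VF)].
Proof.
pose A := [set k | `[< conj_iso 1 i k >]]%SET.
pose ix (a : 'I_#|A|) : 'I_n := enum_val a.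
have ixP a : conj_iso 1 i (ix a) by have := enum_valP a; rewrite inE => /asboolP.
have ch a : exists tt : 'Hom(E i, E (ix a)) * 'Hom(E (ix a), E i),
    [/\ twisted_hom 1 tt.1, twisted_hom 1 tt.2, (tt.2 \o tt.1)%VF = \1%VF &
        (tt.1 \o tt.2)%VF = \1%VF].
  have [t [tt t0]] := ixP a; have [t' [t't tt' t't1]] := twisted_hom_bij tt t0.
  by exists (t, t'); rewrite invg1 in t't1.
pose t a := projT1 (cid (ch a)); have tP a := projT2 (cid (ch a)).
exists #|A|, (fun a => s (ix a) \o (t a).1)%VF, (fun a => (t a).2 \o p (ix a))%VF, ix.
split.
- move=> k; split=> [ik|[a <-] //].
  have kA : k \in A by rewrite inE; apply/asboolP.
  by exists (enum_rank_in kA k); rewrite /ix enum_rankK_in.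
- exact: enum_val_inj.
- move=> a; have [_ _ t2 _] := tP a.
  by rewrite -comp_lfunA (comp_lfunA (p _)) ps1 comp_lfun1l.
- move=> a; have [_ _ _ t2] := tP a.
  by rewrite -comp_lfunA (comp_lfunA (t a).1) t2 comp_lfun1l.
by move=> a; have [t1 t2 _ _] := tP a; split; [exists (t a).1|exists (t a).2].
Qed.

End Clifford.

(** * Coordinates of minimal valuation *)

Section MinimalValuation.
Variables (l : nat) (C : qlbarType l).

(** This set of indices is invariant under scaling of x and locally constant in
    x, so it can be used to normalise a vector that is given up to a scalar. *)
Definition min_valn (K : Type) (x : K -> C) (k : K) :=
  x k != 0 /\ forall k', x k' != 0 -> valn (x k) <= valn (x k').

Lemma min_valn_ex (K : finType) (x : K -> C) :
  (exists k, x k != 0) -> exists k, min_valn x k.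
Proof.
move=> [k0 xk0]; case: (@Order.TotalTheory.arg_minP _ _ _ k0 (fun k => x k != 0)
  (fun k => valn (x k)) xk0) => k xk kmin.
by exists k.
Qed.

(** For a decomposable tensor, minimality of a product is minimality of both
    factors; so the optimal k do not depend on y. *)
Lemma min_valnM (K : Type) (J : finType) (b : K -> C) (y : J -> C) k :
  (exists j, y j != 0) ->
  (exists j, min_valn (fun kj : K * J => b kj.1 * y kj.2) (k, j)) <-> min_valn b k.
Proof.
move=> y0; split=> [[j [/= bky bmin]]|[bk bmin]].
  move: bky; rewrite mulf_eq0 negb_or => /andP[bk yj]; split=> // k' bk'.
  have := bmin (k', j); rewrite /= mulf_neq0 // => /(_ isT).
  by rewrite !valnM // lerD2r.
have [j [yj jmin]] := min_valn_ex y0; exists j; split=> /=; first by rewrite mulf_neq0.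
move=> [k' j'] /=; rewrite mulf_eq0 negb_or => /andP[bk' yj'].
by rewrite !valnM // lerD ?bmin ?jmin.
Qed.

(** Near the limit, the coordinates with nonzero limit keep their valuation and
    the others have a valuation larger than that of a fixed one of the former. *)
Lemma min_valn_near (K : finType) (T : Type) (F : set_system T) {FF : Filter F}
    (r : K -> T -> C) (a : K -> C) :
  (forall k, r k @ F --> a k) -> (exists k, a k != 0) ->
  \forall t \near F, forall k, min_valn (r^~ t) k <-> min_valn a k.
Proof.
move=> ra [k0 ak0].
pose good k t := if a k == 0 then valn_gt (valn (a k0)) (r k t)
                 else (r k t != 0) && (valn (r k t) == valn (a k)).
have near_good : \forall t \near F, forall k, good k t.
  have : forall k, \forall t \near F, good k t.
    move=> k; rewrite /good; have := (cvgCP FF (r k) (a k)).1 (ra k).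
    have [ak|ak] := eqVneq (a k) 0.
      by move=> /(_ (valn (a k0))); rewrite ak; apply: filterS => t; rewrite subr0.
    move=> /(_ (valn (a k))); apply: filterS => t /(valn_near ak)[rk vk].
    by rewrite rk vk eqxx.
  by move=> h; apply: filter_forall.
apply: filterS near_good => t gt k.
have g0 k' : a k' = 0 -> valn_gt (valn (a k0)) (r k' t).
  by move=> ak; have := gt k'; rewrite /good ak eqxx.
have g1 k' : a k' != 0 -> r k' t != 0 /\ valn (r k' t) = valn (a k').
  by move=> ak; have := gt k'; rewrite /good (negPf ak) => /andP[? /eqP].
have [r0 v0] := g1 _ ak0; split=> -[xk kmin].
  have ak : a k != 0.
    apply/eqP => /g0/(_ xk); rewrite ltNge -v0 => /negP; apply.
    exact: kmin.
  split=> // k' ak'; have [rk' vk'] := g1 _ ak'; have [_ vk] := g1 _ ak.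
  by rewrite -vk' -vk; apply: kmin.
have [rk vk] := g1 _ xk; split=> // k' rk'; rewrite vk.
have [ak'|ak'] := eqVneq (a k') 0.
  by apply: ltW; apply: le_lt_trans (kmin _ ak0) (g0 _ ak' rk').
by have [_ ->] := g1 _ ak'; apply: kmin.
Qed.

End MinimalValuation.

(** * Factorisation of an isotypic component *)

Section OneOrbit.
Variables (l : nat) (C : qlbarType l) (G I Q : topGroupType).
Variables (mu : G -> G -> C) (iota : {multiplicative I -> Q}).
Variables (pi : {multiplicative Q -> G}) (V : vectType C) (rho : Q -> 'End(V)).
Hypothesis piQ : is_quotient_by (range iota) pi.
Hypothesis muP : multiplier_on [set: G] mu.
Hypothesis rhoP : representation_on [set: Q] (fun x y => mu (pi x) (pi y)) rho.

Lemma multiplier1 (H : set G) (nu : G -> G -> C) g : is_subgroup H ->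
  multiplier_on H nu -> H g -> nu g 1%g = 1 /\ nu 1%g g = 1.
Proof.
move=> Hs [_ n0 n1 nA] Hg; have H1 := subgroup1 Hs; split.
  have := nA g 1%g 1%g Hg H1 H1; rewrite !mulg1 n1 => /(mulfI (n0 _ _ Hg H1)) //.
have := nA 1%g 1%g g H1 H1 Hg; rewrite !mul1g n1 mul1r.
move/(congr1 (fun z => (nu 1%g g)^-1 * z)).
by rewrite mulVf ?n0 // mulrA mulVf ?n0 // mul1r.
Qed.

Let G_subgroup : is_subgroup [set: G]. Proof. by split. Qed.

Let mu1 g : mu g 1%g = 1 /\ mu 1%g g = 1.
Proof. by apply: multiplier1 muP _. Qed.

Let mu0 g h : mu g h != 0. Proof. by case: muP => _ + _ _; apply. Qed.

Let rhoM q r : (rho q \o rho r)%VF = mu (pi q) (pi r) *: rho (q * r)%g.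
Proof. by case: rhoP => _; apply. Qed.

Lemma pi_iota x : pi (iota x) = 1%g.
Proof. by apply/(quotient_ker piQ); exists x. Qed.

Let rho_bij q : bijective (rho q). Proof. by case: rhoP => [[+ _] _]; apply. Qed.

Lemma rep1 : rho 1%g = \1%VF.
Proof.
have := rhoM 1%g 1%g; rewrite mulg1 multiplicative1 (mu1 1%g).1 scale1r.
move/lfunP => h; apply/lfunP => v; have [f fK _] := rho_bij 1%g.
by apply: (can_inj fK); rewrite -comp_lfunE h id_lfunE.
Qed.

Lemma rep_iotar q x : (rho q \o rho (iota x))%VF = rho (q * iota x)%g.
Proof. by rewrite rhoM pi_iota (mu1 _).1 scale1r. Qed.

Lemma rep_iotal q x : (rho (iota x) \o rho q)%VF = rho (iota x * q)%g.
Proof. by rewrite rhoM pi_iota (mu1 _).2 scale1r. Qed.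

Lemma rep_adm : adm_vec [set: Q] rho.
Proof. by case: rhoP => /admissible_autP[]. Qed.

(** The range of iota is normal as the kernel of pi. *)
Lemma iota_conjl q x : exists y, (q * iota x = iota y * q)%g.
Proof.
have [y _ yE] : range iota (q * iota x * q^-1)%g.
  apply/(quotient_ker piQ).
  by rewrite !gmulfM multiplicativeV pi_iota mulg1 mulgV.
by exists y; rewrite yE mulgVK.
Qed.

Lemma iota_conjr q y : exists x, (q * iota x = iota y * q)%g.
Proof.
have [x xE] := iota_conjl q^-1%g y; exists x.
by rewrite -[iota x](mulgVK q) -xE !mulgA mulgV mul1g.
Qed.

Variables (E : vectType C) (e : I -> 'End(E)).
Hypothesis irrE : irreducible_under e fullv.
Variables (N : nat) (S : 'I_N -> 'Hom(E, V)) (P : 'I_N -> 'Hom(V, E)).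
Hypothesis N_gt0 : (0 < N)%N.
Hypothesis rho_S : forall a x, (rho (iota x) \o S a)%VF = (S a \o e x)%VF.
Hypothesis rho_P : forall a x, (P a \o rho (iota x))%VF = (e x \o P a)%VF.
Hypothesis PS1 : forall a, (P a \o S a)%VF = \1%VF.
Hypothesis PS0 : forall a b, a != b -> (P a \o S b)%VF = 0.
Variable Gj : set G.
Hypothesis Gjs : is_subgroup Gj.
Let H := pi @^-1` Gj.
Hypothesis rho_span : forall q, H q -> forall b u,
  rho q (S b u) = \sum_a S a (P a (rho q (S b u))).

Let X (ab : 'I_N * 'I_N) q := (P ab.1 \o rho q \o S ab.2)%VF.

Let R q x y := (q * iota x = iota y * q)%g.

Let H1 : H 1%g. Proof. by rewrite /H /preimage /= multiplicative1; case: Gjs. Qed.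
Let HM q r : H q -> H r -> H (q * r)%g.
Proof. by rewrite /H /preimage /= gmulfM; apply: subgroupM. Qed.
Let HV q : H q -> H q^-1%g.
Proof. by rewrite /H /preimage /= multiplicativeV; apply: subgroupV. Qed.
Let one_nz : (\1%VF : 'End(E)) != 0 := irreducible_id_neq0 irrE.

Lemma rep_component ab q : intertwines e e (R q) (X ab q).
Proof.
move=> x y qxy; have qx : (rho q \o rho (iota x))%VF = (rho (iota y) \o rho q)%VF.
  by rewrite rep_iotar rep_iotal qxy.
by rewrite /X -(comp_lfunA _ (S ab.2)) -rho_S comp_lfunA
  -(comp_lfunA _ (rho q) (rho _)) qx comp_lfunA
  rho_P !comp_lfunA.
Qed.

Lemma rep_component_iota ab q x : X ab (q * iota x)%g = (X ab q \o e x)%VF.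
Proof. by rewrite /X -rep_iotar -!comp_lfunA rho_S. Qed.

Lemma rep_component_ex q : H q -> exists ab, X ab q != 0.
Proof.
move=> Hq; pose b0 := Ordinal N_gt0; apply: contrapT => nz.
have [u u0] := irreducible_nonzero irrE; case/negP: u0; apply/eqP.
have : rho q (S b0 u) = rho q 0.
  rewrite linear0 rho_span // big1 // => a _.
  have [|z] := eqVneq (X (a, b0) q) 0; last by case: nz; exists (a, b0).
  by move/lfunP/(_ u); rewrite !comp_lfunE zero_lfunE => ->; rewrite linear0.
have [f fK _] := rho_bij q; move/(can_inj fK) => Su.
by rewrite -[u]id_lfunE -(PS1 b0) comp_lfunE Su linear0.
Qed.

Lemma schur_twisted q (f g : 'End(E)) : intertwines e e (R q) f ->
  intertwines e e (R q) g -> f != 0 -> exists c, g = c *: f.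
Proof.
move=> fR gR; apply: intertwines_scale irrE irrE _ _ fR gR.
  exact: iota_conjl.
exact: iota_conjr.
Qed.

Let bE := vbasis {: 'End(E)}.
Let crd q (k : ('I_N * 'I_N) * 'I_(\dim {: 'End(E)})) : C := coord bE k.2 (X k.1 q).

Let coord_nz (f : 'End(E)) : f != 0 -> exists i, coord bE i f != 0.
Proof.
move=> f0; apply/existsP; apply: contraNT f0; rewrite negb_exists => /forallP c0.
rewrite (coord_vbasis (memvf f)) big1 // => i _.
by have := c0 i; rewrite negbK => /eqP ->; rewrite scale0r.
Qed.

(* All coordinates of all blocks are compared at once, rather than the blocks
   with a reference block, because coordinates are defined and continuous on the
   whole of H. *)
Let best ab q := exists i, min_valn (crd q) (ab, i).

Let best_ex q : H q -> exists ab, best ab q.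
Proof.
move=> /rep_component_ex[ab /coord_nz[i xi]].
have [|[ab' i'] m] := @min_valn_ex _ C _ (crd q); first by exists (ab, i).
by exists ab', i'.
Qed.

Let best_nz ab q : best ab q -> X ab q != 0.
Proof. by move=> [i [xi _]]; apply: contraNneq xi => X0; rewrite /crd /= X0 linear0. Qed.

(** The coordinates of the blocks form a decomposable tensor B (x) f, so [best]
    only sees B, and not the operator f to which the blocks are proportional. *)
Let bestP q (f : 'End(E)) (B : 'I_N * 'I_N -> C) :
  f != 0 -> (forall ab, X ab q = B ab *: f) -> forall ab, best ab q <-> min_valn B ab.
Proof.
move=> /coord_nz f0 XB ab; rewrite -(min_valnM B ab f0).
suff xE : crd q = (fun k => B k.1 * coord bE k.2 f) by rewrite /best xE.
by apply/funext => -[k i]; rewrite /crd XB linearZ.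
Qed.

Let component_scale q : H q -> exists (f : 'End(E)) (B : 'I_N * 'I_N -> C),
  f != 0 /\ forall ab, X ab q = B ab *: f.
Proof.
move=> /rep_component_ex[ab0 X0].
have [B XB] := choice (fun ab => schur_twisted (@rep_component ab0 q)
  (@rep_component ab q) X0).
by exists (X ab0 q), B.
Qed.

Lemma act_M y z : e (y * z)%g = (e y \o e z)%VF.
Proof.
pose b0 := Ordinal N_gt0.
have eE w : e w = (P b0 \o rho (iota w) \o S b0)%VF.
  by rewrite -comp_lfunA rho_S comp_lfunA PS1 comp_lfun1l.
rewrite eE gmulfM -rep_iotar -!comp_lfunA rho_S (comp_lfunA (rho _)) rho_S.
by rewrite !comp_lfunA PS1 comp_lfun1l.
Qed.

Lemma act_1 : e 1%g = \1%VF.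
Proof.
pose b0 := Ordinal N_gt0.
have := rho_S b0 1%g; rewrite multiplicative1 rep1 comp_lfun1l.
by move/(congr1 (comp_lfun (P b0))); rewrite comp_lfunA PS1 comp_lfun1l.
Qed.

Lemma act_comp_nz (f : 'End(E)) y : f != 0 -> (f \o e y)%VF != 0.
Proof.
apply: contraNneq => fy; rewrite -[f]comp_lfun1r -act_1 -(mulgV y) act_M.
by rewrite comp_lfunA fy comp_lfun0l.
Qed.

(** Multiplying q by an element of I changes f and leaves B as it is. *)
Let best_iota ab q y : H q -> best ab (q * iota y)%g <-> best ab q.
Proof.
move=> /component_scale[f [B [f0 XB]]].
rewrite (bestP f0 XB) (bestP (act_comp_nz y f0) (B := B)) // => ab'.
by rewrite rep_component_iota XB comp_lfunZl.
Qed.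

Let X_adm ab : adm_vec H (X ab).
Proof.
have [F FE] := compress_lfun (P ab.1) (S ab.2).
apply: eq_adm_vec (fun q _ => esym (FE (rho q))) _.
apply: adm_vec_lin => L; apply: adm_comp (rep_adm L) => // q; exact: cvg_id.
Qed.

Let best_near q : H q ->
  \forall r \near within H (nbhs q), forall ab, best ab r <-> best ab q.
Proof.
move=> Hq; have /component_scale[f [B [f0 XB]]] := Hq.
have xr k : (fun r => crd r k) @ within H (nbhs q) --> crd q k.
  exact: adm_cvg (adm_vec_coord bE k.2 (X_adm k.1)) Hq.
have xnz : exists k, crd q k != 0.
  by have [ab [i [xi _]]] := best_ex Hq; exists (ab, i).
have near_H : Filter (within H (nbhs q)) := within_filter H (nbhs_filter q).
have := min_valn_near (FF := near_H) (r := fun k r => crd r k) xr xnz.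
apply: (@filterS _ _ near_H) => r h ab.
by split=> -[i /h bi]; exists i.
Qed.

Let kap q : option ('I_N * 'I_N) := [pick ab | `[< best ab q >]].

(** The normalised factor A(q): an extension of e to a projective representation
    of H. *)
Definition extension q : 'End(E) := if kap q is Some ab then X ab q else 0.

Let kapP q : H q -> exists2 ab, best ab q & kap q = Some ab.
Proof.
move=> Hq; case kE: (kap q) => [ab|]; move: kE; rewrite /kap; case: pickP => //.
  by move=> ab' /asboolP bab [<-]; exists ab'.
by move=> nb _; have [ab bab] := best_ex Hq; have := nb ab; rewrite /= asboolT.
Qed.

Lemma extension_nz q : H q -> extension q != 0.
Proof. by move=> /kapP[ab /best_nz h k]; rewrite /extension k. Qed.

Lemma extension_tw q : intertwines e e (R q) (extension q).
Proof.
rewrite /extension; case: (kap q) => [ab|]; first exact: rep_component.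
by move=> y z _; rewrite comp_lfun0l comp_lfun0r.
Qed.

Lemma extension_iotar q y : H q -> extension (q * iota y)%g = (extension q \o e y)%VF.
Proof.
move=> Hq; rewrite /extension.
have -> : kap (q * iota y)%g = kap q.
  by apply: eq_pick => ab; apply/asboolP/asboolP => /(best_iota ab y Hq).
case: (kap q) => [ab|]; last by rewrite comp_lfun0l.
exact: rep_component_iota.
Qed.

(** Of the blocks of the identity, only the diagonal ones can be selected. *)
Lemma extension1 : extension 1%g = \1%VF.
Proof.
have := extension_nz H1; rewrite /extension; case: (kap _) => [[a b]|]; last by rewrite eqxx.
rewrite /X /= rep1 comp_lfun1r; have [->|ab] := eqVneq a b; first by rewrite PS1.
by rewrite PS0 // eqxx.
Qed.

Lemma extension_iota y : extension (iota y) = e y.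
Proof.
have := extension_iotar y H1.
by rewrite mul1g extension1 comp_lfun1l.
Qed.

(** [extension] is the sum of the blocks, weighted by the indicator functions of
    the sets where they are selected, which are locally constant. *)
Lemma extension_adm : adm_vec H extension.
Proof.
apply: (@eq_adm_vec _ _ _ _ _ _ (fun q => \sum_ab
    (`[< kap q = Some ab >]%:R : C) *: X ab q)).
  move=> q /kapP[ab _ k]; rewrite /extension k (bigD1 ab) //= big1.
    by rewrite asboolT // scale1r addr0.
  by move=> ab' /negPf nab; rewrite asboolF ?scale0r // => -[] /eqP; rewrite eq_sym nab.
apply: adm_vec_sum => ab; apply: adm_vecZ (X_adm ab).
apply: (@adm_locally_constant _ C _ H [set q | kap q = Some ab]) => q Hq.
have near_H : Filter (within H (nbhs q)) := within_filter H (nbhs_filter q).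
have := best_near Hq; apply: (@filterS _ _ near_H) => r h; congr `[< _ >].
rewrite /= (_ : kap r = kap q) //.
by apply: eq_pick => ab'; apply/asboolP/asboolP => /h.
Qed.

Lemma extension_bij q : H q ->
  exists g, (g \o extension q)%VF = \1%VF /\ (extension q \o g)%VF = \1%VF.
Proof.
move=> Hq; apply: (intertwines_bij (R := R q) irrE irrE).
- exact: iota_conjl.
- exact: iota_conjr.
- exact: extension_tw.
- exact: extension_nz.
Qed.

Lemma extension_comp_nz q r : H q -> H r -> (extension q \o extension r)%VF != 0.
Proof.
move=> Hq Hr; have [g [gA _]] := extension_bij Hq.
apply: contraNneq (extension_nz Hr) => A0.
by rewrite -[extension r]comp_lfun1l -gA -comp_lfunA A0 comp_lfun0r.
Qed.

Let extension_comp_tw q r :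
  intertwines e e (R (q * r)%g) (extension q \o extension r)%VF.
Proof.
move=> y z; rewrite /R => qryz; have [w rw] := iota_conjl r y.
have qw : (q * iota w = iota z * q)%g.
  by apply: (mulIg r); rewrite -mulgA -rw mulgA qryz mulgA.
by rewrite -(comp_lfunA _ _ (e y)) (extension_tw rw) (comp_lfunA _ (e w))
  (extension_tw qw) comp_lfunA.
Qed.

Let sec_ex : exists sec : G -> Q, forall q, exists y, q = (sec (pi q) * iota y)%g.
Proof.
have [sec secP] := choice (quotient_surj piQ); exists sec => q.
by have [_ [y _ <-] qE] := quotient_eq piQ (secP (pi q)); exists y.
Qed.

(** Both sides intertwine e with its conjugate by q r, whence a scalar.  Moving
    elements of I through A(q) shows that the scalar only depends on the images
    of q and r in G. *)
Lemma extension_multiplier : exists nu : G -> G -> C, forall q r, H q -> H r ->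
  (extension q \o extension r)%VF = nu (pi q) (pi r) *: extension (q * r)%g.
Proof.
have [sec secP] := sec_ex.
have Hsec q : H q -> H (sec (pi q)).
  move=> Hq; have [y qE] := secP q; move: Hq.
  by rewrite {1}qE /H /preimage /= gmulfM pi_iota mulg1.
have c_ex (gh : G * G) : exists c : C, H (sec gh.1) -> H (sec gh.2) ->
    (extension (sec gh.1) \o extension (sec gh.2))%VF =
    c *: extension (sec gh.1 * sec gh.2)%g.
  have [Hgh|n] := pselect (H (sec gh.1) /\ H (sec gh.2)); last first.
    by exists 0 => Hg Hh; case: n.
  have [//|c cE] := schur_twisted (@extension_tw (sec gh.1 * sec gh.2)%g)
    (@extension_comp_tw (sec gh.1) (sec gh.2)) _.
    by apply: extension_nz; apply: HM; case: Hgh.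
  by exists c.
have [nu nuP] := choice c_ex.
exists (fun g h => nu (g, h)) => q r Hq Hr.
have [y qE] := secP q; have [z rE] := secP r.
have := nuP (pi q, pi r) (Hsec _ Hq) (Hsec _ Hr); move: (nu _) => c /=.
have := Hsec _ Hq; have := Hsec _ Hr;
  move: (sec (pi q)) (sec (pi r)) qE rE => q' r' -> -> Hr' Hq' cE.
have [w wE] := iota_conjr r' y.
have -> : (q' * iota y * (r' * iota z) = (q' * r') * iota (w * z))%g.
  by rewrite gmulfM !mulgA -(mulgA q' r') wE !mulgA.
rewrite !extension_iotar //; last exact: HM.
rewrite -comp_lfunA (comp_lfunA (e y)) -(extension_tw wE) act_M.
by rewrite comp_lfunZl -cE !comp_lfunA.
Qed.

Lemma components_descend : exists B : G -> 'M[C]_N, forall q, H q ->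
  forall a b, X (a, b) q = B (pi q) a b *: extension q.
Proof.
have [sec secP] := sec_ex.
have Hsec q : H q -> H (sec (pi q)).
  move=> Hq; have [y qE] := secP q; move: Hq.
  by rewrite {1}qE /H /preimage /= gmulfM pi_iota mulg1.
have c_ex (gab : G * ('I_N * 'I_N)) : exists c : C, H (sec gab.1) ->
    X gab.2 (sec gab.1) = c *: extension (sec gab.1).
  case: gab => g ab /=.
  have [Hg|n] := pselect (H (sec g)); last by exists 0.
  have [c cE] := schur_twisted (@extension_tw (sec g)) (@rep_component ab (sec g))
    (extension_nz Hg).
  by exists c.
have [B BP] := choice c_ex.
exists (fun g => \matrix_(a, b) B (g, (a, b))) => q Hq a b; rewrite mxE.
have [y qE] := secP q; have := BP (pi q, (a, b)) (Hsec _ Hq).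
move: (B _) => c /=; have := Hsec _ Hq; move: (sec _) qE => q' -> Hq' cE.
by rewrite rep_component_iota extension_iotar // cE comp_lfunZl.
Qed.

(** The multipliers match because the blocks multiply like matrices:
    sum_c X_ac(q) X_cb(r) = mu X_ab(q r), so B(q) B(r) nu = mu B(q r). *)
Theorem orbit_factorization :
  exists (nu : G -> G -> C) (rhoW : G -> 'End('cV[C]_N)) (rhoE : Q -> 'End(E)),
  [/\ [/\ multiplier_on Gj nu,
          representation_on Gj (fun x y => mu x y * (nu x y)^-1) rhoW &
          representation_on H (fun x y => nu (pi x) (pi y)) rhoE],
      forall y, rhoE (iota y) = e y,
      forall q, H q -> intertwines e e (R q) (rhoE q) &
      forall q, H q -> forall (u : E) (w : 'cV[C]_N),
        rho q (\sum_b w b 0 *: S b u) =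
        \sum_b (rhoW (pi q) w) b 0 *: S b (rhoE q u)].
Proof.
have [nu nuP] := extension_multiplier; have [B BP] := components_descend.
have nu0 q r : H q -> H r -> nu (pi q) (pi r) != 0.
  move=> Hq Hr; apply: contraNneq (extension_comp_nz Hq Hr) => n0.
  by rewrite nuP // n0 scale0r.
have lift g : Gj g -> exists2 q, H q & pi q = g.
  by have [q <-] := quotient_surj piQ g; exists q.
have scaleI (a b : C) (f : 'End(E)) : f != 0 -> a *: f = b *: f -> a = b.
  move=> f0 /eqP; rewrite -subr_eq0 -scalerBl scaler_eq0 (negPf f0) orbF subr_eq0.
  by move/eqP.
have nuM : multiplier_on Gj nu.
  split.
  - pose phi (p : Q * Q) := (pi p.1, pi p.2).
    apply: (adm_descend (phi := phi)).
    + exact: prod_nbhs_image (quotient_nbhs piQ).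
    + move=> [g h]; have [q <-] := quotient_surj piQ g.
      by have [r <-] := quotient_surj piQ h; exists (q, r).
    apply: (adm_quotient (K := 'I_(\dim {: 'End(E)}))
      (g := fun i p => coord bE i (extension (p.1 * p.2)%g))
      (h := fun i p => coord bE i (extension p.1 \o extension p.2)%VF)).
    + move=> i; apply: (adm_comp (phi := fun p : Q * Q => (p.1 * p.2)%g) _ _
        (adm_vec_coord bE i extension_adm)); first exact: mulg_continuous.
      by move=> [q r] [/= Hq Hr]; apply: HM.
    + move=> i; apply: adm_vec_coord; apply: adm_vec_comp => L.
        apply: (adm_comp (phi := fst) _ _ (extension_adm L)).
          by move=> p; apply: cvg_fst.
        by move=> [q r] [].
      apply: (adm_comp (phi := snd) _ _ (extension_adm L)).
        by move=> p; apply: cvg_snd.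
      by move=> [q r] [].
    + by move=> i [q r] [/= Hq Hr]; rewrite nuP // linearZ.
    + by move=> [q r] [/= Hq Hr]; apply: coord_nz; apply: extension_nz; apply: HM.
  - move=> g h /lift[q Hq <-] /lift[r Hr <-]; exact: nu0.
  - have := nuP _ _ H1 H1; rewrite mulg1 multiplicative1 extension1 comp_lfun1l.
    by rewrite -{1}[\1%VF]scale1r => /(scaleI _ _ _ one_nz).
  - move=> g h k /lift[q Hq <-] /lift[r Hr <-] /lift[t Ht <-].
    apply: (scaleI _ _ (extension (q * r * t)%g)).
      by apply: extension_nz; do !apply: HM.
    have := comp_lfunA (extension q) (extension r) (extension t).
    rewrite (nuP r t) // (nuP q r) // -comp_lfunZr -comp_lfunZl nuP ?nuP //; try exact: HM.
    by rewrite !gmulfM !scalerA mulgA mulrC => ->.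
have BM q r : H q -> H r ->
    B (pi q) *m B (pi r) = (mu (pi q) (pi r) * (nu (pi q) (pi r))^-1) *: B (pi q * pi r)%g.
  move=> Hq Hr; apply/matrixP => a b; rewrite !mxE.
  apply: (mulfI (nu0 _ _ Hq Hr)); rewrite !mulrA [nu _ _ * mu _ _]mulrC mulfK ?nu0 //.
  apply: (scaleI _ _ (extension (q * r)%g)); first by apply/extension_nz/HM.
  transitivity (mu (pi q) (pi r) *: X (a, b) (q * r)%g); last first.
    by rewrite (BP _ (HM Hq Hr)) scalerA gmulfM.
  transitivity (\sum_c (X (a, c) q \o X (c, b) r)%VF).
    rewrite mulrC -scalerA -nuP // scaler_suml; apply: eq_bigr => c _.
    by rewrite !BP // -comp_lfunZl -comp_lfunZr scalerA.
  apply/lfunP => u; rewrite sum_lfunE scale_lfunE.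
  transitivity (P a (rho q (rho r (S b u)))).
    rewrite [in RHS](rho_span Hr) !linear_sum; apply: eq_bigr => c _.
    by rewrite !comp_lfunE.
  by rewrite -[rho q _]comp_lfunE rhoM scale_lfunE linearZ !comp_lfunE.
have B1 : B 1%g = 1%:M.
  apply/matrixP => a b; rewrite mxE; apply: (scaleI _ _ _ one_nz).
  rewrite -extension1 -{1}(multiplicative1 pi) -BP // extension1 /X /= rep1 comp_lfun1r.
  have [->|ab] := eqVneq a b; first by rewrite PS1 scale1r.
  by rewrite PS0 // scale0r.
have muW0 q r : H q -> H r -> mu (pi q) (pi r) * (nu (pi q) (pi r))^-1 != 0.
  by move=> Hq Hr; rewrite mulf_neq0 ?invr_eq0 ?nu0.
pose rhoW g : 'End('cV[C]_N) := linfun (mulmx (B g)).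
have rhoWE g w : rhoW g w = B g *m w by rewrite lfunE.
exists nu, rhoW, extension; split=> //.
- split=> //; split.
  + apply/admissible_autP; split.
      move=> g /lift[q Hq <-].
      pose c := mu (pi q) (pi q^-1%g) * (nu (pi q) (pi q^-1%g))^-1.
      pose c' := mu (pi q^-1%g) (pi q) * (nu (pi q^-1%g) (pi q))^-1.
      have c0 : c != 0 by apply: muW0 => //; apply: HV.
      have c0' : c' != 0 by apply: muW0 => //; apply: HV.
      have BB : B (pi q) *m B (pi q^-1%g) = c%:M.
        by rewrite BM //; [rewrite -gmulfM mulgV multiplicative1 B1 scalemx1|exact: HV].
      have BB' : B (pi q^-1%g) *m B (pi q) = c'%:M.
        by rewrite BM //; [rewrite -gmulfM mulVg multiplicative1 B1 scalemx1|exact: HV].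
      exists (fun w => c'^-1 *: (B (pi q^-1%g) *m w)) => w.
        by rewrite rhoWE mulmxA BB' mul_scalar_mx scalerA mulVf // scale1r.
      rewrite rhoWE -scalemxAr mulmxA BB mul_scalar_mx scalerA.
      suff -> : c = c' by rewrite mulVf // scale1r.
      have := mulmxA (B (pi q)) (B (pi q^-1%g)) (B (pi q)).
      rewrite BB BB' mul_mx_scalar mul_scalar_mx => /eqP.
      rewrite -subr_eq0 -scalerBl scaler_eq0 subr_eq0 => /orP[/eqP //|/eqP Bq0].
      move: BB; rewrite Bq0 mul0mx => /matrixP/(_ (Ordinal N_gt0) (Ordinal N_gt0)).
      by rewrite !mxE eqxx => /eqP; rewrite eq_sym (negPf c0).
    move=> L; apply: (adm_descend (quotient_nbhs piQ) (quotient_surj piQ)).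
    move: L; rewrite -/(adm_vec _ _).
    pose D a b : 'End('cV[C]_N) := linfun (mulmx (delta_mx a b)).
    apply: (@eq_adm_vec _ _ _ _ _ _ (fun q => \sum_a \sum_b B (pi q) a b *: D a b)).
      move=> q Hq; apply/lfunP => w; rewrite rhoWE {1}[B _]matrix_sum_delta.
      rewrite mulmx_suml sum_lfunE; apply: eq_bigr => a _.
      rewrite mulmx_suml sum_lfunE; apply: eq_bigr => b _.
      by rewrite scale_lfunE lfunE /= -scalemxAl.
    apply: adm_vec_sum => a; apply: adm_vec_sum => b.
    apply: adm_vecZ; last exact: adm_vec_cst.
    apply: (adm_quotient (K := 'I_(\dim {: 'End(E)}))
      (g := fun i q => coord bE i (extension q))
      (h := fun i q => coord bE i (X (a, b) q))).
    * by move=> i; apply: adm_vec_coord extension_adm.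
    * by move=> i; apply: adm_vec_coord (X_adm (a, b)).
    * by move=> i q Hq; rewrite BP // linearZ.
    * by move=> q Hq; apply/coord_nz/extension_nz.
  + move=> g h /lift[q Hq <-] /lift[r Hr <-]; apply/lfunP => w.
    by rewrite comp_lfunE !rhoWE mulmxA BM // scale_lfunE rhoWE scalemxAl.
  + apply/admissible_autP; split; last exact: extension_adm.
    move=> q Hq; have [g [gA Ag]] := extension_bij Hq; exists g => u.
      by rewrite -comp_lfunE gA id_lfunE.
    by rewrite -comp_lfunE Ag id_lfunE.
  + by move=> q r Hq Hr; apply: nuP.
- exact: extension_iota.
- by move=> q _; apply: extension_tw.
move=> q Hq u w; rewrite linear_sum.
transitivity (\sum_b \sum_a (B (pi q) a b * w b 0) *: S a (extension q u)).
  apply: eq_bigr => b _; rewrite linearZ /= rho_span // scaler_sumr.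
  apply: eq_bigr => a _; have /lfunP/(_ u) := BP q Hq a b.
  by rewrite /X !comp_lfunE /= => ->; rewrite scale_lfunE linearZ scalerA mulrC.
rewrite exchange_big /=; apply: eq_bigr => a _.
by rewrite rhoWE mxE scaler_suml.
Qed.

End OneOrbit.

(** * Finiteness of the projective image *)

Lemma adm_vec_zero_closed (l : nat) (C : qlbarType l) (T : topologicalType)
    (X : vectType C) (f : T -> X) :
  adm_vec [set: T] f -> closed [set x | f x = 0].
Proof.
move=> af; rewrite -openC openE => x /= fx.
have /eqP fx0 : f x <> 0 by [].
have := adm_vec_near_neq0 af (I : [set: T] x) fx0; rewrite near_withinE.
by apply: filterS => y fy /eqP; apply/negP; exact: fy.
Qed.

(** If A q and A r induce the same conjugation on the operators e x with x in s,
    then (A q)^-1 A r commutes with them, hence with all of e, and it is a scalar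
    by Schur's lemma.  So the line of A q is determined by finitely many data,
    each with finitely many values. *)
Lemma finite_projective_conj (l : nat) (C : qlbarType l) (Q : topGroupType)
    (I : groupType) (iota : I -> Q) (E : vectType C) (e : I -> 'End(E))
    (H : set Q) (A : Q -> 'End(E)) (s : seq I) :
  irreducible_under e fullv ->
  (forall q x, exists y, (q * iota x = iota y * q)%g) ->
  (forall q, H q -> bijective (A q)) ->
  (forall q, H q -> intertwines e e (fun x y => (q * iota x = iota y * q)%g) (A q)) ->
  (forall x, finite_set [set e y | y in [set y | exists q, (q * iota x = iota y * q)%g]]) ->
  (forall f : 'End(E), (forall x, x \in s -> (f \o e x)%VF = (e x \o f)%VF) ->
     forall x, (f \o e x)%VF = (e x \o f)%VF) ->
  finite_projective_image H A.
Proof.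
move=> irrE nl Abij Atw fin gen.
have [cj cjP] := choice (fun qx : Q * I => nl qx.1 qx.2).
apply: (@finite_image_factor _ _ _ _ _ (fun q => [seq e (cj (q, x)) | x <- s])).
  apply: (finite_image_map (d := fun x q => e (cj (q, x)))) => x.
  apply: sub_finite_set _ (fin x) => _ [q _ <-].
  by exists (cj (q, x)) => //; exists q; exact: (cjP (q, x)).
move=> q r Hq Hr /eq_in_map eqr.
have [B [BA AB]] : exists B : 'End(E), (B \o A q)%VF = \1%VF /\ (A q \o B)%VF = \1%VF.
  have [g gA _] := Abij q Hq; exists (A q)^-1%VF.
  have k0 : lker (A q) == 0%VS by apply/lker0P; apply: can_inj gA.
  by rewrite lker0_compVf // lker0_compfV.
(* conjugation by B undoes that by A q *)
have Be x : (B \o e (cj (q, x)))%VF = (e x \o B)%VF.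
  rewrite -[LHS]comp_lfun1r -AB -comp_lfunA (comp_lfunA (e _) (A q)).
  by rewrite -(Atw q Hq _ _ (cjP (q, x))) !comp_lfunA BA comp_lfun1l.
have comm x : x \in s -> ((B \o A r) \o e x)%VF = (e x \o (B \o A r))%VF.
  move=> xs; rewrite -comp_lfunA (Atw r Hr _ _ (cjP (r, x))) -(eqr x xs).
  by rewrite !comp_lfunA Be.
have id_tw : intertwines e e eq \1%VF.
  by move=> x _ <-; rewrite comp_lfun1l comp_lfun1r.
have BAr_tw : intertwines e e eq (B \o A r)%VF by move=> x _ <-; apply: gen.
have [u u0] := irreducible_nonzero irrE.
have [||c cE] := intertwines_scale irrE irrE _ _ id_tw BAr_tw
  (irreducible_id_neq0 irrE).
- by move=> x; exists x.
- by move=> x; exists x.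
have {}cE : A r = c *: A q.
  by rewrite -[A r]comp_lfun1l -AB -comp_lfunA cE -comp_lfunZr comp_lfun1r.
have c0 : c != 0.
  apply: contraNneq u0 => c0; have [g gA _] := Abij r Hr; apply/eqP.
  by apply: (can_inj gA); rewrite cE c0 scale0r !zero_lfunE.
apply/seteqP; split=> _ [d d0 <-].
  exists (d / c); first by rewrite /= mulf_neq0 ?invr_eq0.
  by rewrite cE scalerA divfK.
by exists (d * c); [rewrite /= mulf_neq0|rewrite cE scalerA].
Qed.

Section Generation.
Variables (I Q Ib Qb : topGroupType) (iota : {multiplicative I -> Q}).
Variables (I' : set I) (pI : {multiplicative I -> Ib}) (pQ : {multiplicative Q -> Qb}).
Variables (Z : choiceType) (rho : Q -> Z) (op : Z -> Z -> Z).
Hypothesis pI_quo : is_quotient_by I' pI.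
Hypothesis pQ_quo : is_quotient_by [set iota i | i in I'] pQ.
Hypothesis I'fin : finite_set [set rho (iota i) | i in I'].

(** For s take lifts of topological generators of I / I', together with
    representatives in I' of the elements of rho(I'): a subgroup saturated for
    rho that contains the latter contains I'. *)
Lemma finite_generation : topologically_fg Ib ->
  exists s : seq I, forall A : set I, closed A -> is_subgroup A ->
    (forall x y, A x -> rho (iota x) = rho (iota y) -> A y) ->
    (forall x, x \in s -> A x) -> A = [set: I].
Proof.
move=> [T /finite_seqP[t ->] tgen].
have [sec secP] := choice (quotient_surj pI_quo).
have [u uI' uP] : exists2 u : seq I, forall x, x \in u -> I' x &
    forall x, I' x -> exists2 y, y \in u & rho (iota y) = rho (iota x).
  have [v vE] := (finite_seqP _).1 I'fin.
  have rep_ex z : exists i, z \in v -> I' i /\ rho (iota i) = z.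
    have [zv|zv] := boolP (z \in v); last by exists 1%g.
    have [i I'i <-] : [set rho (iota i) | i in I'] z by rewrite vE.
    by exists i.
  have [rep repP] := choice rep_ex.
  exists (map rep v) => [_ /mapP[z zv ->]|x I'x]; first by case: (repP z zv).
  have xv : rho (iota x) \in v.
    by have : [set rho (iota i) | i in I'] (rho (iota x)); [exists x|rewrite vE].
  by exists (rep (rho (iota x))); [exact: map_f|case: (repP _ xv)].
exists (u ++ map sec t) => A clA sA Arho As.
apply: (closed_subgroup_full pI_quo tgen clA sA).
  move=> x /uP[y yu yx]; apply: Arho yx; apply: As; by rewrite mem_cat yu.
move=> b /= bt; exists (sec b) => //; apply: As.
by rewrite mem_cat map_f ?orbT.
Qed.

(** The elements of Q that commute with I modulo I' form an open subgroup, which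
    has finitely many cosets z W.  For h in W the conjugate of x by h is x i with
    i in I', so the conjugate by z h differs from that by z by an element of I',
    whose image under rho is one of finitely many. *)
Lemma finite_conjugates :
  compact [set: Q] -> is_normal [set iota i | i in I'] ->
  open (centralizer_set (range (fun i => pQ (iota i)))) ->
  (forall q x, exists y, q * iota x = iota y * q)%g ->
  (forall x y, rho (iota (x * y)%g) = op (rho (iota x)) (rho (iota y))) ->
  forall x, finite_set
    [set rho (iota y) | y in [set y | exists q, (q * iota x = iota y * q)%g]].
Proof.
move=> cQ [_ norm] oZ nl rhoM x.
have oW : open (pQ @^-1` centralizer_set (range (fun i => pQ (iota i)))).
  by have [_ _ pO] := pQ_quo; apply/pO.
have [|t tP] := open_finite_cosets cQ oW.
  by move=> _ [i _ <-]; rewrite multiplicative1 mul1g mulg1.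
have [cj cjP] := choice (fun z => nl z x).
have fin2 := finite_image2 op
  (finite_image (fun z => rho (iota (cj z))) (finite_seq t)) I'fin.
apply: sub_finite_set _ fin2 => _ [y [q qxy] <-].
have [z zt Wz] := tP q.
have [i I'i iE] : [set iota i | i in I'] ((iota x)^-1 * ((z^-1 * q) * iota x * (z^-1 * q)^-1))%g.
  apply/(quotient_ker pQ_quo); rewrite !gmulfM !multiplicativeV.
  have := Wz (pQ (iota x)); rewrite /= !gmulfM multiplicativeV => ->; last by exists x.
  by rewrite mulgK mulVg.
have [i' I'i' i'E] := norm z _ (ex_intro2 _ _ i I'i (erefl _)).
exists (rho (iota (cj z))); first by exists z.
exists (rho (iota i')); first by exists i'.
rewrite -rhoM; congr (rho _).
rewrite gmulfM i'E iE !mulgA -(cjP z) ?mulgA.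
by rewrite mulgK mulgV mul1g qxy invgM invgK mulgA !mulgK.
Qed.

End Generation.

(** * Tensor products and induction *)

Section TensorMaps.
Variables (R : comNzRingType) (A V : lmodType R).
Variables (B : Type) (ra : A -> B -> A) (lv : B -> V -> V).

Local Notation tens := (tens ra lv).

Lemma tens_repr (u : tensor ra lv) :
  u = \sum_(k <- msupp (repr u : {malg R[(A * V)%type]}))
    (repr u : {malg R[(A * V)%type]})@_k *: tens k.1 k.2.
Proof.
rewrite -{1}[u]reprqK {1}[repr u]monalgE linear_sum; apply: eq_bigr => -[a v] _.
set c := _@_(a, v).
have -> : << c *g (a, v) >> = c *: << (a, v) >> :> {malg R[(A * V)%type]}.
  by apply/malgP => k; rewrite mcoeffZ !mcoeffU mulr_natr.
by rewrite linearZ.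
Qed.

(** [tensor_map] is computed on a representative, and any representative is a
    combination of pure tensors. *)
Lemma tensor_map_lift (P P' : lmodType R) (f : A -> A) (g : V -> V)
    (phi : {linear tensor ra lv -> P'}) (psi : {linear tensor ra lv -> P})
    (L : {linear P -> P'}) :
  (forall a v, phi (tens (f a) (g v)) = L (psi (tens a v))) ->
  forall u, phi (tensor_map f g u) = L (psi u).
Proof.
move=> h u; rewrite [in RHS](tens_repr u) !linear_sum; apply: eq_bigr => k _.
by rewrite !linearZ /= h.
Qed.

End TensorMaps.

Section InducedSum.
Variables (K : fieldType) (Q : groupType) (m : Q -> Q -> K).
Hypothesis m0 : forall x y, m x y != 0.
Variables (V : vectType K) (rho : Q -> 'End(V)).
Hypothesis rho1 : rho 1%g = \1%VF.
Hypothesis rhoM : forall x y v, rho x (rho y v) = m x y *: rho (x * y)%g v.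

Definition malg_act (v : V) (a : {malg K[Q]}) : V :=
  \sum_(x <- msupp a) a@_x *: rho x v.

Lemma malg_actEw (d : {fset Q}) a v : (msupp a `<=` d)%fset ->
  malg_act v a = \sum_(x <- d) a@_x *: rho x v.
Proof.
move=> ad; rewrite /malg_act (big_fset_incl _ ad) // => x _ /mcoeff_outdom ->.
by rewrite scale0r.
Qed.

Lemma malg_actU x v : malg_act v << x >> = rho x v.
Proof.
rewrite (@malg_actEw [fset x]%fset) ?msuppU_le //.
by rewrite big_seq_fset1 mcoeffUU scale1r.
Qed.

Lemma malg_act_linear v : linear (malg_act v).
Proof.
move=> c a b; pose d := (msupp a `|` msupp b `|` msupp (c *: a + b))%fset.
have da : (msupp a `<=` d)%fset by rewrite /d -fsetUA fsubsetUl.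
have db : (msupp b `<=` d)%fset by rewrite /d fsetUAC fsubsetUr.
have dab : (msupp (c *: a + b) `<=` d)%fset by rewrite fsubsetUr.
rewrite (malg_actEw _ da) (malg_actEw _ db) (malg_actEw _ dab) scaler_sumr.
rewrite -big_split /=; apply: eq_bigr => k _.
by rewrite mcoeffD mcoeffZ scalerDl scalerA.
Qed.

HB.instance Definition _ v := GRing.isLinear.Build K {malg K[Q]} V _
  (malg_act v) (malg_act_linear v).

Lemma malg_actP a c u v : malg_act (c *: u + v) a = c *: malg_act u a + malg_act v a.
Proof.
rewrite /malg_act scaler_sumr -big_split /=; apply: eq_bigr => x _.
by rewrite linearP scalerDr !scalerA mulrC.
Qed.

Lemma malg_act_mul a b v : malg_act v (tw_mul m a b) = malg_act (malg_act v b) a.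
Proof.
rewrite linear_sum; apply: eq_bigr => x _.
have -> : rho x (malg_act v b) = \sum_(y <- msupp b) b@_y *: rho x (rho y v).
  by rewrite linear_sum; apply: eq_bigr => y _; rewrite linearZ.
rewrite linear_sum scaler_sumr; apply: eq_bigr => y _.
by rewrite linearZ /= malg_actU rhoM !scalerA.
Qed.

Section Component.
Variables (H : set Q) (T : lmodType K) (sigma : Q -> T -> T).
Variables (theta : {linear T -> V}).
Hypothesis theta_sigma : forall h t, H h -> theta (sigma h t) = rho h (theta t).

Local Notation ind := (@induced K Q m H T sigma).
Local Notation itens a t := (tens (fun z b => tw_mul m z (sval b))
  (@tw_act K Q H T sigma) a t : ind).

(** Frobenius reciprocity: [theta] is H-equivariant, hence extends to the
    representation induced from T. *)
Lemma frobenius_lift : exists F : {linear ind -> V},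
  forall a t, F (itens a t) = malg_act (theta t) a.
Proof.
apply: tensor_universal => [a a' t|a t t'|c a t|c a t|a b t].
- by rewrite linearD.
- by rewrite -[t]scale1r linearP malg_actP !scale1r.
- by rewrite linearZ.
- have := malg_actP a c (theta t) 0; rewrite addr0 linearZ => ->.
  suff -> : malg_act 0 a = 0 by rewrite addr0.
  by rewrite /malg_act big1 // => x _; rewrite linear0 scaler0.
rewrite malg_act_mul; congr (malg_act _ a); rewrite /tw_act linear_sum.
by apply: eq_big_seq => h hb; rewrite linearZ /= theta_sigma //; apply: (svalP b).
Qed.

Lemma frobenius_equivariant (F : {linear ind -> V}) :
  (forall a t, F (itens a t) = malg_act (theta t) a) ->
  forall x u, F (induced_act x u) = rho x (F u).
Proof.
move=> FE x; apply: (tensor_map_lift (phi := F) (psi := F) (L := rho x)) => a t.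
transitivity (malg_act (theta t) (tw_mul m << x >> a)); first exact: FE.
by rewrite malg_act_mul malg_actU -FE.
Qed.

Lemma itens_linear t : linear (fun a => itens a t).
Proof. by move=> c a b; rewrite tensDl tensZl. Qed.

Lemma induced_ext (P : lmodType K) (F F' : {linear ind -> P}) :
  (forall x t, F (itens << x >> t) = F' (itens << x >> t)) -> F =1 F'.
Proof.
move=> e; apply: tensor_ext => a t.
pose f_linear := GRing.isLinear.Build _ _ _ _ (fun a => itens a t) (itens_linear t).
pose f : {linear {malg K[Q]} -> ind} := HB.pack (fun a => itens a t) f_linear.
rewrite -[tens _ _ a t]/(f a) [a]malg_span !linear_sum; apply: eq_bigr => x _.
by rewrite !linearZ /= e.
Qed.

(** Elements of H pass through the tensor sign, so the induced module is spanned
    by the r (x) t with r in a transversal. *)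
Lemma itens_coset x h t : H h ->
  itens << (x * h)%g >> t = (m x h)^-1 *: itens << x >> (sigma h t).
Proof.
move=> Hh.
have supp_h h' : h' \in msupp (<< h >> : {malg K[Q]}) -> H h'.
  by move/(fsubsetP msuppU_le _); rewrite inE => /eqP ->.
pose b : @tw_sub K Q H := exist _ << h >> supp_h.
have -> : sigma h t = tw_act sigma b t.
  rewrite /tw_act /= (big_fset_incl _ msuppU_le) /=; last first.
    by move=> y _ /mcoeff_outdom ->; rewrite scale0r.
  by rewrite big_seq_fset1 mcoeffUU scale1r.
by rewrite -tensB /= tw_mulUU tensZl scalerA mulVf // scale1r.
Qed.

End Component.

Section SumOfInduced.
Variables (J : finType) (H : J -> set Q) (T : J -> lmodType K).
Variables (sigma : forall j, Q -> T j -> T j).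
Variables (theta : forall j, {linear T j -> V}) (theta' : forall j, {linear V -> T j}).
Hypothesis Hs : forall j, is_subgroup (H j).
Hypothesis Hfin : forall j, finite_index (H j).
Hypothesis theta_sigma : forall j h t, H j h -> theta j (sigma h t) = rho h (theta j t).
Hypothesis thetaK : forall j t, theta' j (theta j t) = t.
Hypothesis theta_coset : forall j q t, ~ H j q -> theta' j (rho q (theta j t)) = 0.
Hypothesis theta_orth : forall i j q t, i != j -> theta' i (rho q (theta j t)) = 0.
Hypothesis theta_gen : forall v, exists n (j : 'I_n -> J) (q : 'I_n -> Q)
  (t : forall k, T (j k)), v = \sum_k rho (q k) (theta (j k) (t k)).

(* Only the following properties of the induced module [ind j] matter, where
   [tn j x t] stands for its element x (x) t. *)
Variables (ind : J -> lmodType K) (F : forall j, {linear ind j -> V}).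
Variable tn : forall j, Q -> T j -> ind j.
Hypothesis tn_linear : forall j x, linear (@tn j x).
Hypothesis tn_coset : forall j x h t, H j h ->
  @tn j (x * h)%g t = (m x h)^-1 *: tn x (sigma h t).
Hypothesis tn_ext : forall j (P : lmodType K) (f g : {linear ind j -> P}),
  (forall x t, f (tn x t) = g (tn x t)) -> f =1 g.
Hypothesis F_tn : forall j x t, F j (tn x t) = rho x (theta j t).

(** For a transversal r of H i, send v to the sum of the r_k (x) theta'(r_k^-1 v).
    On the element x (x) t only the term of the coset of x survives, and the
    elements of the other summands are killed. *)
Lemma induced_left_inverse i : exists G : {linear V -> ind i},
  (forall u, G (F i u) = u) /\ forall j u, i != j -> G (F j u) = 0.
Proof.
have tnZ j x c t : @tn j x (c *: t) = c *: tn x t.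
  have tn0 : @tn j x 0 = 0.
    have := @tn_linear j x 1 0 0; rewrite !scale1r addr0 => /(congr1 (+%R^~ (- tn x 0))).
    by rewrite addrK subrr.
  by have := @tn_linear j x c t 0; rewrite !addr0 tn0 addr0.
have [n [r rP]] := transversal_ex (Hs i) (Hfin i).
pose g v : ind i :=
  \sum_k (m (r k)^-1%g (r k))^-1 *: tn (r k) (theta' i (rho (r k)^-1%g v)).
have g_lin : linear g.
  move=> c u v; rewrite /g scaler_sumr -big_split; apply: eq_bigr => k _ /=.
  by rewrite !linearP tn_linear scalerDr !scalerA mulrC.
pose g_linear := GRing.isLinear.Build _ _ _ _ g g_lin.
pose G : {linear V -> ind i} := HB.pack g g_linear.
exists G; split=> [u|j u ij].
  suff /(_ u) : G \o F i =1 idfun by [].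
  apply: tn_ext => x t; rewrite /= F_tn /g.
  have [k [Hk kuniq]] := rP x; rewrite (bigD1 k) //= big1 ?addr0; last first.
    move=> k' /eqP kk'; rewrite rhoM linearZ /= theta_coset ?scaler0.
      by rewrite -(scaler0 _ 0) tnZ !scale0r scaler0.
    by move=> /kuniq.
  set h := ((r k)^-1 * x)%g in Hk.
  have xE : x = (r k * h)%g by rewrite mulVKg.
  have -> : rho x (theta i t) = (m (r k) h)^-1 *: rho (r k) (theta i (sigma h t)).
    by rewrite theta_sigma // rhoM -xE scalerA mulVf // scale1r.
  rewrite linearZ /= rhoM mulVg rho1 id_lfunE !linearZ /= thetaK.
  by rewrite [in RHS]xE tn_coset // !tnZ !scalerA mulrC mulfK.
suff /(_ u) : G \o F j =1 \0 by [].
apply: tn_ext => x t; rewrite /= F_tn /g big1 // => k _.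
by rewrite rhoM linearZ /= theta_orth // -(scale0r 0) !tnZ !scale0r !scaler0.
Qed.

(** The left inverses of [induced_left_inverse] show independence, and theta_gen
    gives generation. *)
Lemma sum_of_induced_bij :
  bijective (fun t : forall j, ind j => \sum_j F j (t j)).
Proof.
pose G i := projT1 (cid (induced_left_inverse i)).
have GF i u : G i (F i u) = u.
  by have [+ _] := projT2 (cid (induced_left_inverse i)); apply.
have GF0 i j u : i != j -> G i (F j u) = 0.
  by move=> ij; have [_ +] := projT2 (cid (induced_left_inverse i)); apply.
pose FF (t : forall j, ind j) := \sum_j F j (t j).
have GFF t : (fun i => G i (FF t)) = t.
  apply: functional_extensionality_dep => i; rewrite /FF linear_sum (bigD1 i) //=.
  by rewrite GF big1 ?addr0 // => j ji; rewrite GF0 // eq_sym.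
have FF_surj v : exists t, FF t = v.
  have [n [j [q [t ->]]]] := theta_gen v.
  elim/big_rec: _ => [|k w _ [t' <-]].
    by exists (fun=> 0); rewrite /FF big1 // => i _; rewrite linear0.
  pose t0 : forall i, ind i := @dfwith _ ind (fun i => 0) (j k) (tn (q k) (t k)).
  exists (fun i => t0 i + t' i).
  rewrite /FF; under eq_bigr do rewrite linearD; rewrite big_split; congr (_ + _).
  rewrite (bigD1 (j k)) //= /t0 dfwith_in F_tn big1 ?addr0 //.
  by move=> i ij; rewrite dfwith_out 1?eq_sym // linear0.
exists (fun v i => G i v) => [t|v]; first exact: GFF.
by have [t <-] := FF_surj v; rewrite -[LHS]/(FF (fun i => G i (FF t))) GFF.
Qed.

End SumOfInduced.

(** The hypotheses say that the translates of the images of the [theta j] are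
    independent and span V. *)
Theorem sum_of_induced (J : finType) (H : J -> set Q) (T : J -> lmodType K)
    (sigma : forall j, Q -> T j -> T j)
    (theta : forall j, {linear T j -> V}) (theta' : forall j, {linear V -> T j}) :
  (forall j, is_subgroup (H j)) -> (forall j, finite_index (H j)) ->
  (forall j h t, H j h -> theta j (sigma j h t) = rho h (theta j t)) ->
  (forall j t, theta' j (theta j t) = t) ->
  (forall j q t, ~ H j q -> theta' j (rho q (theta j t)) = 0) ->
  (forall i j q t, i != j -> theta' i (rho q (theta j t)) = 0) ->
  (forall v, exists n (j : 'I_n -> J) (q : 'I_n -> Q) (t : forall k, T (j k)),
     v = \sum_k rho (q k) (theta (j k) (t k))) ->
  direct_sum_isomorphic (fun x => rho x : V -> V)
    (fun j => @induced_act K Q m (H j) (T j) (sigma j)).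
Proof.
move=> Hs Hfin theta_sigma thetaK theta_coset theta_orth theta_gen.
pose F j := projT1 (cid (frobenius_lift (theta_sigma j))).
have FE j a t := projT2 (cid (frobenius_lift (theta_sigma j))) a t.
exists (fun t => \sum_j F j (t j)); split.
- apply: (sum_of_induced_bij Hs Hfin theta_sigma thetaK theta_coset theta_orth
    theta_gen (tn := fun j x t => tens (fun z b => tw_mul m z (sval b))
      (@tw_act K Q (H j) (T j) (sigma j)) << x >> t)).
  + by move=> j x c t t'; rewrite tensDr tensZr.
  + by move=> j x h t; apply: itens_coset.
  + by move=> j P f g; apply: induced_ext.
  + by move=> j x t; rewrite /F FE malg_actU.
- by move=> s t; rewrite -big_split; apply: eq_bigr => j _; rewrite linearD.
- by move=> c t; rewrite scaler_sumr; apply: eq_bigr => j _; rewrite linearZ.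
move=> x t; rewrite linear_sum; apply: eq_bigr => j _.
exact: (frobenius_equivariant (FE j)).
Qed.

End InducedSum.

Section IsotypicTensor.
Variables (K : fieldType) (V E : vectType K) (N : nat).
Variables (S : 'I_N -> 'Hom(E, V)) (P : 'I_N -> 'Hom(V, E)).
Hypothesis PS1 : forall a, (P a \o S a)%VF = \1%VF.
Hypothesis PS0 : forall a b, a != b -> (P a \o S b)%VF = 0.

Local Notation EW := (tensor_sp E 'cV[K]_N).
Local Notation etens e w := (tens (fun (y : E) c => c *: y)
  (fun c (z : 'cV[K]_N) => c *: z) e w : EW).

(** A basis of the multiplicity space identifies E (x) W with a sum of copies of
    E, which the S a embed in V. *)
Lemma isotypic_tensor : exists (theta : {linear EW -> V}) (theta' : {linear V -> EW}),
  [/\ forall e w, theta (etens e w) = \sum_b w b 0 *: S b e,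
      forall t, theta' (theta t) = t &
      forall v, theta' v = \sum_a etens (P a v) (delta_mx a 0)].
Proof.
have [theta thetaE] : exists theta : {linear EW -> V},
    forall e w, theta (etens e w) = \sum_b w b 0 *: S b e.
  apply: tensor_universal => [e e' w|e w w'|c e w|c e w|e c w].
  - by rewrite -big_split; apply: eq_bigr => b _; rewrite linearD scalerDr.
  - by rewrite -big_split; apply: eq_bigr => b _; rewrite mxE scalerDl.
  - by rewrite scaler_sumr; apply: eq_bigr => b _; rewrite linearZ !scalerA mulrC.
  - by rewrite scaler_sumr; apply: eq_bigr => b _; rewrite mxE scalerA.
  - by apply: eq_bigr => b _; rewrite mxE linearZ scalerA mulrC.
pose g v : EW := \sum_a etens (P a v) (delta_mx a 0).
have g_lin : linear g.
  move=> c u v; rewrite /g scaler_sumr -big_split; apply: eq_bigr => a _ /=.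
  by rewrite linearP tensDl tensZl.
pose g_linear := GRing.isLinear.Build _ _ _ _ g g_lin.
pose theta' : {linear V -> EW} := HB.pack g g_linear.
exists theta, theta'; split=> // t.
suff /(_ t) : theta' \o theta =1 idfun by [].
apply: tensor_ext => e w; rewrite /= thetaE /g.
have w_lin : linear (fun w => etens e w).
  by move=> c u v; rewrite tensDr tensZr.
pose w_linear := GRing.isLinear.Build _ _ _ _ (fun w => etens e w) w_lin.
pose f : {linear 'cV[K]_N -> EW} := HB.pack (fun w => etens e w) w_linear.
rewrite -[RHS]/(f w) [in RHS](matrix_sum_delta w) linear_sum; apply: eq_bigr => a _.
rewrite big_ord1 linearZ /= -tensZl; congr tens.
rewrite linear_sum (bigD1 a) //= big1 ?addr0.
  by rewrite linearZ /= -comp_lfunE PS1 id_lfunE.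
move=> b ba; rewrite linearZ /= -comp_lfunE PS0 1?eq_sym //.
by rewrite zero_lfunE scaler0.
Qed.

Lemma isotypic_tensor_rep (Q : Type) (theta : {linear EW -> V}) (rho : 'End(V))
    (rE : Q -> E -> E) (rW : Q -> 'cV[K]_N -> 'cV[K]_N) (q : Q) :
  (forall e w, theta (etens e w) = \sum_b w b 0 *: S b e) ->
  (forall e (w : 'cV[K]_N), rho (\sum_b w b 0 *: S b e) = \sum_b (rW q w) b 0 *: S b (rE q e)) ->
  forall t, theta (tensor_rep rE rW q t) = rho (theta t).
Proof.
move=> thetaE h; apply: (tensor_map_lift (phi := theta) (psi := theta) (L := rho)).
move=> e w; apply: etrans (thetaE _ _) _; apply: etrans (esym (h e w)) _.
by congr (rho _); exact: esym (thetaE e w).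
Qed.

End IsotypicTensor.

(** * The orbits of Q on the irreducible components *)

Lemma choice_family (A : Type) (T : A -> Type) (R : forall a, T a -> Prop) :
  (forall a, exists t, R a t) -> exists f : forall a, T a, forall a, R a (f a).
Proof.
by move=> h; exists (fun a => projT1 (cid (h a))) => a; exact: projT2 (cid (h a)).
Qed.

Section Assembly.
Variables (l : nat) (C : qlbarType l) (G I Q : topGroupType).
Variables (mu : G -> G -> C) (iota : {multiplicative I -> Q}).
Variables (pi : {multiplicative Q -> G}) (V : vectType C) (rho : Q -> 'End(V)).
Hypothesis piQ : is_quotient_by (range iota) pi.
Hypothesis muP : multiplier_on [set: G] mu.
Hypothesis rhoP : representation_on [set: Q] (fun x y => mu (pi x) (pi y)) rho.
Hypothesis rhoI : representation_on [set: I] (fun _ _ => 1) (fun i => rho (iota i)).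
Variable gens : seq I.
Hypothesis gensP : forall A : set I, closed A -> is_subgroup A ->
  (forall x y, A x -> rho (iota x) = rho (iota y) -> A y) ->
  (forall x, x \in gens -> A x) -> A = [set: I].
Hypothesis conj_fin : forall x, finite_set
  [set rho (iota y) | y in [set y | exists q, (q * iota x = iota y * q)%g]].

Variables (n : nat) (E : 'I_n -> vectType C).
Variables (s : forall i, 'Hom(E i, V)) (p : forall i, 'Hom(V, E i)).
Hypothesis ps1 : forall i, (p i \o s i)%VF = \1%VF.
Hypothesis ps0 : forall i j, i != j -> (p i \o s j)%VF = 0.
Hypothesis sp1 : \sum_i (s i \o p i)%VF = \1%VF.
Variable e : forall i, I -> 'End(E i).
Hypothesis eE : forall i x, e i x = (p i \o rho (iota x) \o s i)%VF.
Hypothesis rho_s : forall i x, (rho (iota x) \o s i)%VF = (s i \o e i x)%VF.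
Hypothesis irr : forall i, irreducible_under (e i) fullv.

Local Notation conj := (conj_iso iota e).

Let mu1 g : mu g 1%g = 1 /\ mu 1%g g = 1.
Proof. by apply: multiplier1 muP _ => //; split. Qed.
Let m0 (q r : Q) : mu (pi q) (pi r) != 0.
Proof. by case: muP => _ + _ _; apply. Qed.
Let mI (q : Q) (x : I) : mu (pi q) (pi (iota x)) = 1 /\ mu (pi (iota x)) (pi q) = 1.
Proof. by rewrite (pi_iota piQ); split; have [] := mu1 (pi q). Qed.
Let rhoM (q r : Q) : (rho q \o rho r)%VF = mu (pi q) (pi r) *: rho (q * r)%g.
Proof. by case: rhoP => _; apply. Qed.
Let rho1 : rho 1%g = \1%VF := rep1 muP rhoP.
Let nl := iota_conjl piQ.
Let nr := iota_conjr piQ.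

Let conj_comp q r i j k : conj q i j -> conj r j k -> conj (r * q)%g i k.
Proof. by move=> h1 h2; exact: (conj_iso_comp nl nr irr h1 h2). Qed.
Let conj_inv q i k : conj q i k -> conj q^-1%g k i.
Proof. by move=> h; exact: (conj_iso_inv nl nr irr h). Qed.
Let comp_conj q i k : (p k \o rho q \o s i)%VF != 0 -> conj q i k.
Proof. by move=> h; exact: (component_conj_iso rhoM mI ps1 ps0 sp1 rho_s h). Qed.

Let comp_conj_nz q i k u : p k (rho q (s i u)) != 0 -> conj q i k.
Proof.
by move=> nz; apply: comp_conj; apply: contraNneq nz => /lfunP/(_ u);
  rewrite !comp_lfunE zero_lfunE => ->.
Qed.

(** The nonzero block provided by [stabilizerE] remains nonzero nearby. *)
Lemma stabilizer_open i : open [set q | conj q i i].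
Proof.
rewrite openE => q /= /(stabilizerE rhoM m0 mI rho1 nl nr ps1 ps0 sp1 rho_s irr).
move=> [k ik qk].
have [F FE] := compress_lfun (p k) (s i).
have := adm_vec_near_neq0 (adm_vec_lin F (rep_adm rhoP)) (Logic.I : [set: Q] q).
rewrite FE => /(_ qk); rewrite near_withinE; apply: filterS => r /(_ Logic.I).
rewrite FE => rk; apply/(stabilizerE rhoM m0 mI rho1 nl nr ps1 ps0 sp1 rho_s irr).
by exists k.
Qed.

Definition orbit_group i : set G := [set pi q | q in [set q | conj q i i]].

Lemma orbit_groupE i q : (pi @^-1` orbit_group i) q <-> conj q i i.
Proof.
split=> [[r /= rii /(quotient_eq piQ)[_ [x _ <-] ->]]|qii]; last by exists q.
apply: conj_comp rii; exact: (conj_iso_iota rhoM m0 mI rho1 ps1 ps0 sp1 rho_s irr).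
Qed.

Lemma orbit_group_subgroup i : is_subgroup (orbit_group i).
Proof.
have st : is_subgroup [set q | conj q i i].
  exact: (stabilizer_subgroup nl nr ps1 rho_s irr).
split=> [|_ _ [q Hq <-] [r Hr <-]|_ [q Hq <-]].
- by exists 1%g; [exact: subgroup1 st|rewrite multiplicative1].
- by exists (q * r)%g; [exact: subgroupM st _ _ Hq Hr|rewrite gmulfM].
- by exists q^-1%g; [exact: subgroupV st _ Hq|rewrite multiplicativeV].
Qed.

Lemma orbit_group_open i : open (orbit_group i).
Proof. exact: (quotient_open_map piQ (stabilizer_open i)). Qed.

(** The coset of q is determined by the class to which q sends that of E i. *)
Lemma orbit_group_finite_index i : finite_index (orbit_group i).
Proof.
have [sec secP] := choice (quotient_surj piQ).
apply: (finite_index_factor (orbit_group_subgroup i)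
  (d := fun g => [set k | `[< conj (sec g) i k >]]%SET)).
  exact: finite_finset.
move=> g h eqd.
have [k /comp_conj gk] := component_ex rhoM m0 rho1 ps1 sp1 irr (sec g) i.
have hk : conj (sec h) i k.
  have : k \in [set k | `[< conj (sec g) i k >]]%SET by rewrite inE; apply/asboolP.
  by rewrite eqd inE => /asboolP.
exists ((sec g)^-1 * sec h)%g; first exact: conj_comp hk (conj_inv gk).
by rewrite gmulfM multiplicativeV !secP.
Qed.

(** Everything that the statement asks of the orbit of E i.  The maps [theta] and
    [theta'] are the inclusion and the projection of the isotypic component,
    characterised by the components E k that occur in it; this is all that is
    needed to compare different orbits. *)
Lemma orbit_data i : exists (N : nat) (nu : G -> G -> C)
    (rhoW : G -> 'End('cV[C]_N)) (rhoE : Q -> 'End(E i))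
    (theta : {linear tensor_sp (E i) 'cV[C]_N -> V})
    (theta' : {linear V -> tensor_sp (E i) 'cV[C]_N}),
  let H := pi @^-1` orbit_group i in
  [/\ [/\ multiplier_on (orbit_group i) nu,
          representation_on (orbit_group i) (fun x y => mu x y * (nu x y)^-1) rhoW &
          representation_on H (fun x y => nu (pi x) (pi y)) rhoE],
      [/\ finite_projective_image H rhoE,
          irreducible_under (fun x => rhoE (iota x)) fullv &
          exists f : 'End(V) -> 'End(E i), forall x, rhoE (iota x) = f (rho (iota x))],
      forall h t, H h -> theta (@tensor_rep C Q (E i) 'cV[C]_N
          (fun x => rhoE x) (fun x => rhoW (pi x)) h t) = rho h (theta t),
      forall t, theta' (theta t) = t &
      [/\ forall t k, p k (theta t) != 0 -> conj 1%g i k,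
          forall v, (forall k, conj 1%g i k -> p k v = 0) -> theta' v = 0 &
          forall v, (forall k, p k v != 0 -> conj 1%g i k) -> theta (theta' v) = v]].
Proof.
have [N [S [P [ix [ixP ix_inj PS1 SP SPt]]]]] := isotypic_ex nl nr ps1 irr i.
have SE a : exists t : 'Hom(E i, E (ix a)),
    twisted_hom iota e 1%g t /\ S a = (s (ix a) \o t)%VF by case: (SPt a).
have PE a : exists t : 'Hom(E (ix a), E i),
    twisted_hom iota e 1%g t /\ P a = (t \o p (ix a))%VF by case: (SPt a).
have PS0 a b : a != b -> (P a \o S b)%VF = 0.
  move=> ab; have [t [_ ->]] := SE b; have [t' [_ ->]] := PE a.
  rewrite -comp_lfunA (comp_lfunA (p _)) ps0 ?comp_lfun0l ?comp_lfun0r //.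
  by rewrite (inj_eq ix_inj).
have N_gt0 : (0 < N)%N.
  have [a _] := (ixP i).1 (conj_iso1 ps1 rho_s irr i).
  exact: leq_ltn_trans (leq0n a) (ltn_ord a).
have tw1 j k (t : 'Hom(E j, E k)) x : twisted_hom iota e 1%g t -> (t \o e j x)%VF = (e k x \o t)%VF.
  by move=> ht; apply: ht; rewrite mul1g mulg1.
have rho_S a x : (rho (iota x) \o S a)%VF = (S a \o e i x)%VF.
  have [t [ht ->]] := SE a.
  by rewrite comp_lfunA rho_s -comp_lfunA -(tw1 _ _ _ _ ht) comp_lfunA.
have rho_P a x : (P a \o rho (iota x))%VF = (e i x \o P a)%VF.
  have [t [ht ->]] := PE a.
  by rewrite -comp_lfunA (rho_p ps1 ps0 sp1 rho_s) comp_lfunA (tw1 _ _ _ _ ht) comp_lfunA.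
have sum_SP v : (forall k, p k v != 0 -> conj 1%g i k) -> \sum_a S a (P a v) = v.
  move=> vi; rewrite -[RHS](sum_components sp1).
  have -> : \sum_a S a (P a v) = \sum_(k in [set ix a | a in 'I_N]%SET) s k (p k v).
    rewrite big_imset /=; last by move=> a b _ _; apply: ix_inj.
    by apply: eq_bigr => a _; rewrite -comp_lfunE SP comp_lfunE.
  rewrite big_mkcond; apply: eq_bigr => k _; case: ifP => // /negP kix.
  have [->|/vi/ixP[a ak]] := eqVneq (p k v) 0; first by rewrite linear0.
  by case: kix; apply/imsetP; exists a.
have S_conj a k u : p k (S a u) != 0 -> conj 1%g i k.
  have [t [_ ->]] := SE a; rewrite comp_lfunE => nz; apply/ixP; exists a.
  have [//|ak] := eqVneq (ix a) k; have := ps0 (_ : k != ix a).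
  by rewrite eq_sym => /(_ ak)/lfunP/(_ (t u)); rewrite comp_lfunE zero_lfunE => z;
    rewrite z eqxx in nz.
have span q : (pi @^-1` orbit_group i) q -> forall b u,
    rho q (S b u) = \sum_a S a (P a (rho q (S b u))).
  move=> /orbit_groupE qii b u; rewrite sum_SP // => k.
  rewrite -{1}(sum_components sp1 (S b u)) !linear_sum => nz.
  have [j jnz] : exists j, p k (rho q (s j (p j (S b u)))) != 0.
    apply/existsP; apply: contraNT nz; rewrite negb_exists => /forallP z.
    by rewrite big1 // => j _; have := z j; rewrite negbK => /eqP.
  have ij : conj 1%g i j.
    apply: (S_conj b j u); apply: contraNneq jnz => ->; by rewrite !linear0.
  have := conj_comp (conj_comp (conj_inv qii) ij) (comp_conj_nz jnz).
  by rewrite mul1g mulgV.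
have [nu [rhoW [rhoE [[nuM repW repE] rhoEi rhoEt rhoEW]]]] :=
  orbit_factorization piQ muP rhoP (irr i) N_gt0 rho_S rho_P PS1 PS0
    (orbit_group_subgroup i) span.
have [theta [theta' [thetaE thetaK theta'E]]] := isotypic_tensor PS1 PS0.
exists N, nu, rhoW, rhoE, theta, theta'; split=> //.
- split.
  + apply: (@finite_projective_conj _ _ _ _ iota _ (e i) _ _ gens) => //.
    * by case: repE => [[]].
    * move=> x; have [F FE] := compress_lfun (p i) (s i).
      apply: sub_finite_set _ (finite_image F (conj_fin x)) => _ [y qy <-].
      by exists (rho (iota y)); [exists y|rewrite FE eE].
    (* The set of the x whose operator commutes with f is a closed subgroup. *)
    * move=> f fg; have [F FE] : exists F : 'Hom('End(V), 'End(E i)), forall g,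
          F g = (f \o (p i \o g \o s i))%VF - ((p i \o g \o s i) \o f)%VF.
        apply: linear_lfun => c g h.
        apply/lfunP => u; rewrite !(add_lfunE, opp_lfunE, scale_lfunE, comp_lfunE).
        by rewrite !linearP /= scalerDr addrACA.
      have adm_I : adm_vec [set: I] (fun x => rho (iota x)).
        by have [/admissible_autP[]] := rhoI.
      have e1 := act_1 muP rhoP N_gt0 rho_S PS1.
      have eM := act_M piQ muP rhoP N_gt0 rho_S PS1.
      suff commT : [set x | (f \o e i x)%VF = (e i x \o f)%VF] = [set: I].
        by move=> x; have : [set: I] x by []; rewrite -commT.
      apply: gensP => //.
      - rewrite (_ : [set x | _] = [set x | F (rho (iota x)) = 0]).
          exact: adm_vec_zero_closed (adm_vec_lin F adm_I).
        apply/seteqP; split=> x /=; rewrite FE -eE; first by move=> ->; rewrite subrr.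
        by move/eqP; rewrite subr_eq0 => /eqP.
      - split=> [|x y /= fx fy|x /= fx] /=.
        + by rewrite e1 comp_lfun1l comp_lfun1r.
        + by rewrite eM comp_lfunA fx -comp_lfunA fy comp_lfunA.
        + rewrite -[LHS]comp_lfun1l -e1 -(mulVg x) eM -comp_lfunA (comp_lfunA (e i x)).
          by rewrite -fx -(comp_lfunA f) -eM mulgV e1 comp_lfun1r.
      - by move=> x y /=; rewrite !eE => fx <-.
  + rewrite (_ : (fun x => rhoE (iota x)) = e i) //.
    by apply/funext => x; rewrite rhoEi.
  + exists (fun f => p i \o f \o s i)%VF => x; rewrite rhoEi; exact: eE.
- move=> h t Hh; apply: (isotypic_tensor_rep (q := h) thetaE) => u w.
  exact: rhoEW.
- split.
  + move=> t k; apply: contra_neqP => ik.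
    suff /(_ t) : p k \o theta =1 \0 by [].
    apply: tensor_ext => u w; rewrite /= thetaE linear_sum big1 // => b _.
    rewrite linearZ /=; have [->|/S_conj //] := eqVneq (p k (S b u)) 0.
    by rewrite scaler0.
  + move=> v vi; rewrite theta'E big1 // => a _; have [t [_ ->]] := PE a.
    rewrite comp_lfunE vi; last by apply/ixP; exists a.
    by rewrite linear0 -(scale0r 0) tensZl scale0r.
  + move=> v /sum_SP vE; rewrite theta'E linear_sum -[RHS]vE; apply: eq_bigr => a _.
    rewrite thetaE (bigD1 a) //= big1 ?addr0 ?mxE ?eqxx ?scale1r // => b ba.
    by rewrite mxE (negPf ba) scale0r.
Qed.

(** Follow a nonzero component: from E j to an isomorphic E a, by q to some E k,
    and E k is isomorphic to E i; so q maps the class of E j to that of E i. *)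
Lemma orbit_separation i j (T T' : lmodType C) (theta : T -> V) (theta' : V -> T') q :
  (forall t k, p k (theta t) != 0 -> conj 1%g j k) ->
  (forall v, (forall k, conj 1%g i k -> p k v = 0) -> theta' v = 0) ->
  ~ conj q j i -> forall t, theta' (rho q (theta t)) = 0.
Proof.
move=> theta_supp theta'_supp nji t; apply: theta'_supp => k ik.
rewrite -(sum_components sp1 (theta t)) !linear_sum big1 // => a _.
apply: contra_notP nji => /eqP nz.
have ja : conj 1%g j a.
  by apply: (theta_supp t); apply: contraNneq nz => ->; rewrite !linear0.
have := conj_comp (conj_comp ja (comp_conj_nz nz)) (conj_inv ik).
by rewrite invg1 mul1g mulg1.
Qed.

(** Since q maps the class of E i to that of E k, its inverse brings E k into the
    isotypic component of E i. *)
Lemma orbit_translate i k q (T : Type) (theta : T -> V) (theta' : V -> T) v :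
  conj q i k -> (forall v, (forall k, p k v != 0 -> conj 1%g i k) ->
    theta (theta' v) = v) ->
  s k v = rho q (theta (theta' ((mu (pi q) (pi q^-1%g))^-1 *: rho q^-1%g (s k v)))).
Proof.
move=> ik thetaK; rewrite thetaK.
  by rewrite linearZ /= -comp_lfunE rhoM mulgV rho1 scale_lfunE id_lfunE scalerA
    mulVf // scale1r.
move=> k'; rewrite linearZ scaler_eq0 negb_or => /andP[_ /comp_conj_nz h].
by rewrite -(mulVg q); exact: conj_comp ik h.
Qed.

Definition orbit_rep i : 'I_n := odflt i [pick k | `[< exists q, conj q i k >]].

Lemma orbit_rep_conj i : exists q, conj q (orbit_rep i) i.
Proof.
rewrite /orbit_rep; case: pickP => [k /asboolP[q qik]|_] /=.
  by exists q^-1%g; exact: conj_inv.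
by exists 1%g; exact: (conj_iso1 ps1 rho_s irr).
Qed.

Lemma orbit_rep_eq i k q : conj q i k -> orbit_rep i = orbit_rep k.
Proof.
move=> qik; rewrite /orbit_rep.
have <- : [pick k' | `[< exists q, conj q i k' >]] =
    [pick k' | `[< exists q, conj q k k' >]].
  apply: eq_pick => k'; apply/asboolP/asboolP => -[r h].
    by exists (r * q^-1)%g; exact: conj_comp (conj_inv qik) h.
  by exists (r * q)%g; exact: conj_comp qik h.
case: pickP => //= /(_ k) /asboolP []; by exists q.
Qed.

Lemma orbit_repK i : orbit_rep (orbit_rep i) = orbit_rep i.
Proof. by have [q /orbit_rep_eq] := orbit_rep_conj i. Qed.

End Assembly.

Unset Implicit Arguments.

Theorem proposition2p40 (l : nat) (l_prime : prime l) (C : qlbarType l)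
    (G I Q : topGroupType) (mu : G -> G -> C)
    (iota : {multiplicative I -> Q}) (pi : {multiplicative Q -> G})
    (V : vectType C) (rho : Q -> 'End(V))
    (* [Ib] and [Qb] are the quotients of I and Q by [I']. *)
    (I' : set I) (Ib Qb : topGroupType)
    (pI : {multiplicative I -> Ib}) (pQ : {multiplicative Q -> Qb}) :
  profinite G -> multiplier_on [set: G] mu ->
  profinite I -> profinite Q ->
  is_embedding iota -> is_quotient_by (range iota) pi ->
  representation_on [set: Q] (fun x y => mu (pi x) (pi y)) rho ->
  representation_on [set: I] (fun _ _ => 1) (fun i => rho (iota i)) ->
  semisimple (fun i => rho (iota i)) ->
  closed I' -> is_subgroup I' -> is_normal [set iota i | i in I'] ->
  is_quotient_by I' pI -> is_quotient_by [set iota i | i in I'] pQ ->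
  finite_set [set rho (iota i) | i in I'] ->
  topologically_fg Ib ->
  open (centralizer_set (range (fun i => pQ (iota i)))) ->
  exists (J : finType) (Gj : J -> set G) (nu : J -> G -> G -> C)
         (W E : J -> vectType C)
         (rhoW : forall j, G -> 'End(W j)) (rhoE : forall j, Q -> 'End(E j)),
    let Qj j := pi @^-1` Gj j in
    [/\ forall j, [/\ is_subgroup (Gj j), open (Gj j) & finite_index (Gj j)],
        forall j,
          [/\ multiplier_on (Gj j) (nu j),
              representation_on (Gj j)
                (fun x y => mu x y * (nu j x y)^-1) (rhoW j) &
              representation_on (Qj j)
                (fun x y => nu j (pi x) (pi y)) (rhoE j)],
        forall j,
          [/\ finite_projective_image (Qj j) (rhoE j),
              irreducible_under (fun i => rhoE j (iota i)) fullv &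
              exists f : 'End(V) -> 'End(E j),
                forall i, rhoE j (iota i) = f (rho (iota i))] &
        direct_sum_isomorphic (fun x => rho x : V -> V)
          (fun j => @induced_act C Q (fun x y => mu (pi x) (pi y)) (Qj j)
             (tensor_sp (E j) (W j))
             (@tensor_rep C Q (E j) (W j)
                (fun x => rhoE j x) (fun x => rhoW j (pi x))))].
Proof.
move=> _ muP _ [cQ _ _] _ piQ rhoP rhoI ss _ _ normI' pIq pQq I'fin tfg oZ.
have [gens gensP] := finite_generation pIq I'fin tfg.
have rho_iotaM x y : rho (iota (x * y)%g) = (rho (iota x) \o rho (iota y))%VF.
  by rewrite gmulfM (rep_iotar piQ muP rhoP).
have conj_fin := finite_conjugates pQq I'fin cQ normI' oZ (iota_conjl piQ) rho_iotaM.
have [n [E [s [p [ps1 ps0 sp1 rho_s irr]]]]] := semisimple_split ss.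
pose e i x := (p i \o rho (iota x) \o s i)%VF.
have D := orbit_data piQ muP rhoP rhoI gensP conj_fin ps1 ps0 sp1
  (fun i x => erefl (e i x)) rho_s irr.
have [N DN] := choice_family D.
have [nu Dnu] := choice_family DN.
have [rhoW DW] := choice_family Dnu.
have [rhoE DE] := choice_family DW.
have [theta Dt] := choice_family DE.
have [theta' {}D] := choice_family Dt.
pose J : finType := {i : 'I_n | orbit_rep iota e i == i}.
exists J, (fun j => orbit_group iota pi e (val j)), (fun j => nu (val j)),
  (fun j => 'cV[C]_(N (val j))), (fun j => E (val j)),
  (fun j => rhoW (val j)), (fun j => rhoE (val j)) => Qj.
have groupE i q : (pi @^-1` orbit_group iota pi e i) q <-> conj_iso iota e q i i.
  exact: (orbit_groupE piQ muP rhoP ps1 ps0 sp1 rho_s irr).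
have subgrp i : is_subgroup (orbit_group iota pi e i).
  exact: (orbit_group_subgroup piQ ps1 rho_s irr).
have fin_ix i : finite_index (orbit_group iota pi e i).
  exact: (orbit_group_finite_index piQ muP rhoP ps1 ps0 sp1 rho_s irr).
split=> [j|j|j|].
- split=> //.
  exact: (orbit_group_open piQ muP rhoP ps1 ps0 sp1 rho_s irr).
- by have [] := D (val j).
- by have [] := D (val j).
have separation i j q : ~ conj_iso iota e q j i ->
    forall t, theta' i (rho q (theta j t)) = 0.
  have [_ _ _ _ [theta_supp _ _]] := D j; have [_ _ _ _ [_ theta'_supp _]] := D i.
  exact: (orbit_separation piQ muP rhoP ps1 ps0 sp1 rho_s irr theta_supp theta'_supp).
have rep_eq i k q : conj_iso iota e q i k -> orbit_rep iota e i = orbit_rep iota e k.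
  exact: (orbit_rep_eq piQ irr).
apply: (@sum_of_induced C Q (fun x y => mu (pi x) (pi y)) _ V rho _ _ J Qj
  (fun j => tensor_sp (E (val j)) 'cV[C]_(N (val j))) _
  (fun j => theta (val j)) (fun j => theta' (val j))).
- by case: muP => _ + _ _ q r; apply.
- exact: rep1 muP rhoP.
- by move=> q r v; case: rhoP => _ rhoM; rewrite -comp_lfunE rhoM // scale_lfunE.
- by move=> j; apply: preimage_subgroup.
- by move=> j; apply: preimage_finite_index.
- by move=> j h t; have [_ _ + _ _] := D (val j); apply.
- by move=> j t; have [_ _ _ + _] := D (val j); apply.
- by move=> j q t nq; apply: separation => /groupE.
- move=> i j q t ij; apply: separation => /rep_eq ji; case/eqP: ij.
  by apply: val_inj; rewrite -(eqP (valP i)) -(eqP (valP j)) ji.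
move=> v; have rep_ex k : exists j : J, exists q, conj_iso iota e q (val j) k.
  have repP : orbit_rep iota e (orbit_rep iota e k) == orbit_rep iota e k.
    by apply/eqP; exact: (orbit_repK piQ ps1 rho_s irr).
  by exists (exist (fun i => orbit_rep iota e i == i) _ repP);
    exact: (orbit_rep_conj piQ ps1 rho_s irr).
have [j jP] := choice rep_ex; have [q qP] := choice jP.
exists n, j, q, (fun k => theta' (val (j k))
  ((mu (pi (q k)) (pi (q k)^-1%g))^-1 *: rho (q k)^-1%g (s k (p k v)))).
rewrite -[LHS](sum_components sp1); apply: eq_bigr => k _.
have [_ _ _ _ [_ _ theta_id]] := D (val (j k)).
exact: (orbit_translate piQ muP rhoP ps1 ps0 sp1 rho_s irr _ (qP k) theta_id).
Qed.
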